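(* Let $n\ge3$ and let $P\in\mathcal I(n)$ be nonzero and indecomposable, and suppose that $P$ contains (with nonzero coefficient) a pure monomial $X_j^{\deg P}$ for some $j\in\{0,\dots,n\}$. Then $$\operatorname{p-degree}(P)\le\frac{2n\,(2N(P)-5)}{3n^2-3n-2}\le\frac43\cdot\frac{2N(P)-5}{2n-3}.$$
   Context: $S(X)=X_0+X_1+\dots+X_n$. $\mathcal I(n)$ denotes the set of homogeneous polynomials $P\in\mathbb R[X_0,\dots,X_n]$ with $P(X)=0$ whenever $S(X)=0$. $N(P)$ is the number of distinct monomials of $P$ with nonzero coefficient. The p-degree of $P$ is the smallest integer $d$ such that $P=X^\alpha R$ for some monomial $X^\alpha$ and some polynomial $R$ of degree $d$. $P\in\mathcal I(n)$ is indecomposable if one cannot write $P=P_1+P_2$ with $P_1,P_2\in\mathcal I(n)$ both nonzero and having no monomial in common. *)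

(* Defs.v *)
(* real coefficients (Stdlib Reals), polynomials in
   X_0..X_n represented as finite lists of (exponent vector, coefficient)
   pairs; the coefficient of a monomial is the sum of the coefficients of
   all entries carrying that exponent vector. *)
From Stdlib Require Import Reals List Arith.
Import ListNotations.
Open Scope R_scope.

(* exponent vector (alpha_0,...,alpha_n) *)
Definition mono := list nat.
Definition mpoly := list (mono * R).

Definition mono_eq_dec : forall a b : mono, {a = b} + {a <> b} := list_eq_dec Nat.eq_dec.

Definition coef (P : mpoly) (m : mono) : R :=
  fold_right (fun p acc => if mono_eq_dec (fst p) m then snd p + acc else acc) 0 P.

Definition wf (n : nat) (P : mpoly) : Prop :=
  Forall (fun p => length (fst p) = S n) P.

Definition mnonzero (P : mpoly) : Prop := exists m, coef P m <> 0.

Definition mdeg (m : mono) : nat := fold_right plus 0%nat m.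

Definition homogeneous (P : mpoly) : Prop :=
  exists d, forall m, coef P m <> 0 -> mdeg m = d.

Fixpoint mon_eval_from (x : nat -> R) (m : mono) (k : nat) : R :=
  match m with
  | [] => 1
  | e :: m' => x k ^ e * mon_eval_from x m' (S k)
  end.

Definition eval (P : mpoly) (x : nat -> R) : R :=
  fold_right (fun p acc => snd p * mon_eval_from x (fst p) 0 + acc) 0 P.

Definition Ssum (n : nat) (x : nat -> R) : R := sum_f_R0 x n.

Definition In_I (n : nat) (P : mpoly) : Prop :=
  wf n P /\ homogeneous P /\ forall x, Ssum n x = 0 -> eval P x = 0.

Definition Nmon (P : mpoly) : nat :=
  length (nodup mono_eq_dec
    (filter (fun m => if Req_EM_T (coef P m) 0 then false else true) (map fst P))).

Definition is_deg (P : mpoly) (d : nat) : Prop :=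
  (exists m, coef P m <> 0 /\ mdeg m = d) /\
  (forall m, coef P m <> 0 -> (mdeg m <= d)%nat).

Definition indecomposable (n : nat) (P : mpoly) : Prop :=
  ~ exists P1 P2 : mpoly,
      In_I n P1 /\ In_I n P2 /\ mnonzero P1 /\ mnonzero P2 /\
      (forall m, coef P m = coef P1 m + coef P2 m) /\
      (forall m, coef P1 m = 0 \/ coef P2 m = 0).

Definition pure (n j d : nat) : mono :=
  map (fun i => if Nat.eqb i j then d else 0%nat) (seq 0 (S n)).

Definition vadd (a m : mono) : mono := map (fun pr => (fst pr + snd pr)%nat) (combine a m).
Definition mul_mono (a : mono) (Rp : mpoly) : mpoly :=
  map (fun p => (vadd a (fst p), snd p)) Rp.

Definition factors_with_deg (n : nat) (P : mpoly) (d : nat) : Prop :=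
  exists (a : mono) (Rp : mpoly),
    length a = S n /\ wf n Rp /\ is_deg Rp d /\
    forall m, coef P m = coef (mul_mono a Rp) m.

Definition pdegree (n : nat) (P : mpoly) (d : nat) : Prop :=
  factors_with_deg n P d /\ forall d', factors_with_deg n P d' -> (d <= d')%nat.

(* Main.v *)
Require Import Defs.
From Stdlib Require Import Reals List Arith.
From Stdlib Require Import Lra Lia Permutation Classical.
Import ListNotations.
Open Scope R_scope.

(* Put n = r + 2 and D = 2r + 1, and let M be the transition operator of a walk on the naturals that
   moves from h by +1 with probability a_h and by +2 with probability b_h, where a and b are
   D-periodic.  From heights divisible by D it satisfies
     M^D = sum_{k <= r} C_k shift^D M^k + Cinf shift^{2D},
   with positive constants adding up to 1.  Substituting - M^D for the pure variable X_j and the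
   n = r + 2 terms of the right-hand side for the other variables therefore kills S, hence P: each
   monomial of P becomes a multiple of M^w applied to a point mass, and these add up to 0.
   Sum the terms in the order of decreasing w.  In the sequence (-1)^h q(h) each application of M
   lengthens a maximal alternating chain by one, while adding a point mass shortens it by at most
   two.  As no proper partial sum vanishes while the full sum does, the spread of the exponents w is
   at most 2 N(P) - 5.  A partial sum has total mass the value at (C_k, Cinf) of a proper part of P,
   which is not identically zero on S = 0 because P is indecomposable; a choice of b of widely
   separated orders of magnitude makes one monomial dominate, so that this value is not zero.
   Averaging the inequality over the cyclic rotations of the n other variables gives the bound. *)

(** * Finite real sums indexed by lists *)

Fixpoint lsum {A : Type} (f : A -> R) (l : list A) : R :=
  match l with [] => 0 | x :: l' => f x + lsum f l' end.

Lemma lsum_app {A} (f : A -> R) l1 l2 : lsum f (l1 ++ l2) = lsum f l1 + lsum f l2.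
Proof. induction l1 as [|x l1 IH]; simpl; [ring | rewrite IH; ring]. Qed.

Lemma lsum_ext {A} (f g : A -> R) l :
  (forall x, In x l -> f x = g x) -> lsum f l = lsum g l.
Proof.
  induction l as [|x l IH]; simpl; intros H; [reflexivity|].
  rewrite (H x), IH; auto.
Qed.

Lemma lsum_map {A B} (f : B -> R) (g : A -> B) l : lsum f (map g l) = lsum (fun x => f (g x)) l.
Proof. induction l as [|x l IH]; simpl; [reflexivity | now rewrite IH]. Qed.

Lemma lsum_plus {A} (f g : A -> R) l : lsum (fun x => f x + g x) l = lsum f l + lsum g l.
Proof. induction l as [|x l IH]; simpl; [ring | rewrite IH; ring]. Qed.

Lemma lsum_scal {A} (c : R) (f : A -> R) l : lsum (fun x => c * f x) l = c * lsum f l.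
Proof. induction l as [|x l IH]; simpl; [ring | rewrite IH; ring]. Qed.

Lemma lsum_zero {A} (f : A -> R) l : (forall x, In x l -> f x = 0) -> lsum f l = 0.
Proof.
  induction l as [|x l IH]; simpl; intros H; [reflexivity|].
  rewrite (H x), IH; auto; ring.
Qed.

Lemma lsum_perm {A} (f : A -> R) l l' : Permutation l l' -> lsum f l = lsum f l'.
Proof. induction 1; simpl; lra. Qed.

Lemma lsum_flat_map {A B} (f : B -> R) (g : A -> list B) l :
  lsum f (flat_map g l) = lsum (fun x => lsum f (g x)) l.
Proof. induction l as [|x l IH]; simpl; [reflexivity | now rewrite lsum_app, IH]. Qed.

Lemma lsum_swap {A B} (f : A -> B -> R) l l' :
  lsum (fun x => lsum (f x) l') l = lsum (fun y => lsum (fun x => f x y) l) l'.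
Proof.
  induction l as [|x l IH]; simpl.
  - symmetry; apply lsum_zero; reflexivity.
  - rewrite IH, lsum_plus; reflexivity.
Qed.

Lemma lsum_le {A} (f g : A -> R) l :
  (forall x, In x l -> f x <= g x) -> lsum f l <= lsum g l.
Proof.
  induction l as [|x l IH]; simpl; intros H; [lra|].
  apply Rplus_le_compat; auto.
Qed.

Lemma lsum_abs {A} (f : A -> R) l : Rabs (lsum f l) <= lsum (fun x => Rabs (f x)) l.
Proof.
  induction l as [|x l IH]; simpl; [rewrite Rabs_R0; lra|].
  eapply Rle_trans; [apply Rabs_triang|lra].
Qed.

(** * Alternating chains *)

(** Only the sign of [sg] matters; letting it be any real allows a nonzero value of the sequence to
    serve as the sign of the chain that it starts. *)
Fixpoint alt (s : nat -> R) (l : nat) (sg : R) (h : nat) : Prop :=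
  match l with
  | O => True
  | S l' => exists k, (h <= k)%nat /\ 0 < sg * s k /\ alt s l' (- sg) (S k)
  end.

Lemma alt_start s l : forall sg h h', (h' <= h)%nat -> alt s l sg h -> alt s l sg h'.
Proof.
  destruct l as [|l]; simpl; intros sg h h' Hh H; [exact I|].
  destruct H as [k [Hk H]]; exists k; split; [lia | exact H].
Qed.

Lemma alt_ext s s' l : (forall k, s k = s' k) -> forall sg h, alt s l sg h -> alt s' l sg h.
Proof.
  intros E; induction l as [|l IH]; simpl; intros sg h H; [exact I|].
  destruct H as [k [Hk [Hs H]]]; exists k; rewrite <- E; auto.
Qed.

Lemma alt_ext_from s s' l : forall h sg,
  (forall k, (h <= k)%nat -> s k = s' k) -> alt s l sg h -> alt s' l sg h.
Proof.
  induction l as [|l IH]; simpl; intros h sg E H; [exact I|].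
  destruct H as [k [Hk [Hs H]]]; exists k; rewrite <- E by lia; repeat split; auto.
  apply IH; auto; intros; apply E; lia.
Qed.

(* Deleting the element at [c] together with one neighbour restores alternation. *)
Lemma alt_change_one s s' c : (forall k, k <> c -> s k = s' k) ->
  forall l sg h, alt s l sg h -> alt s' (l - 2) sg h.
Proof.
  intros E; induction l as [|l IH]; intros sg h H; simpl; [exact I|].
  destruct H as [k [Hk [Hs H]]].
  destruct l as [|[|l]]; try exact I.
  destruct (Nat.eq_dec k c) as [->|Hc].
  - destruct H as [k2 [Hk2 [Hs2 H]]].
    replace (S (S (S l)) - 2)%nat with (S l) by lia.
    rewrite Ropp_involutive in H.
    apply (alt_start _ _ _ (S k2)); [lia|].
    apply (alt_ext_from s); auto; intros; apply E; lia.
  - replace (S (S (S l)) - 2)%nat with (S (S (S l) - 2))%nat by lia.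
    exists k; split; [exact Hk|]; split; [rewrite <- E by auto; exact Hs|].
    apply IH in H; replace (S (S l) - 2)%nat with l in H by lia; exact H.
Qed.

(** The positions of a chain are distinct points of the support. At the end of the sweep this bounds
    the chain by the number of point masses that must cancel it. *)
Lemma alt_support s F : (forall k, s k <> 0 -> In k F) ->
  forall l sg h, alt s l sg h -> (l <= length (filter (fun k => h <=? k)%nat F))%nat.
Proof.
  intros HF; induction l as [|l IH]; intros sg h H; [lia|].
  destruct H as [k [Hk [Hs H]]]; apply IH in H.
  assert (Hin : In k F) by (apply HF; intros E; rewrite E in Hs; lra).
  assert (Hlt : (length (filter (fun j => S k <=? j)%nat F)
                 < length (filter (fun j => h <=? j)%nat F))%nat).
  { assert (Hle : forall G, (length (filter (fun j => S k <=? j)%nat G)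
                   <= length (filter (fun j => h <=? j)%nat G))%nat).
    { induction G as [|x G IHG]; cbn [filter]; [lia|].
      destruct (S k <=? x)%nat eqn:E1; destruct (h <=? x)%nat eqn:E2; cbn [length]; try lia.
      apply Nat.leb_le in E1; apply Nat.leb_gt in E2; lia. }
    clear -Hin Hk Hle; induction F as [|x F IHF]; [destruct Hin|].
    cbn [filter]. destruct Hin as [->|Hin].
    - destruct (S k <=? k)%nat eqn:E1; [apply Nat.leb_le in E1; lia|].
      destruct (h <=? k)%nat eqn:E2; [|apply Nat.leb_gt in E2; lia].
      cbn [length]; specialize (Hle F); lia.
    - specialize (IHF Hin).
      destruct (S k <=? x)%nat eqn:E1; destruct (h <=? x)%nat eqn:E2; cbn [length]; try lia.
      apply Nat.leb_le in E1; apply Nat.leb_gt in E2; lia. }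
  lia.
Qed.

(** Bounded support forces a positive run to end. Its last point [pred k] is where the walk operator
    reproduces the sign. *)
Lemma first_nonpositive (s : nat -> R) sg B h : (forall k, (B < k)%nat -> s k = 0) -> 0 < sg * s h ->
  exists k, (h < k)%nat /\ sg * s k <= 0 /\ 0 < sg * s (pred k) /\
    forall j, (h <= j)%nat -> sg * s j <= 0 -> (k <= j)%nat.
Proof.
  intros HB Hh.
  remember (S B - h)%nat as t eqn:Ht; revert h Hh Ht.
  induction t as [|t IH]; intros h Hh Ht.
  - rewrite (HB h) in Hh by lia; lra.
  - destruct (Rle_lt_dec (sg * s (S h)) 0) as [Hle|Hlt].
    + exists (S h); simpl; repeat split; auto; try lia.
      intros j Hj Hs; destruct (Nat.eq_dec j h) as [->|]; [lra | lia].
    + destruct (IH (S h) Hlt) as [k [Hk1 [Hk2 [Hk3 Hk4]]]]; [lia|].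
      exists k; repeat split; auto; try lia.
      intros j Hj Hs; destruct (Nat.eq_dec j h) as [->|]; [lra|].
      apply Hk4; auto; lia.
Qed.

Lemma positive_run_start (s : nat -> R) sg h : 0 < sg * s h ->
  exists k, (k <= h)%nat /\ 0 < sg * s k /\ (k = 0%nat \/ sg * s (pred k) <= 0).
Proof.
  induction h as [|h IH]; intros Hh; [exists 0%nat; auto|].
  destruct (Rle_lt_dec (sg * s h) 0) as [Hle|Hlt].
  - exists (S h); auto.
  - destruct (IH Hlt) as [k [Hk H]]; exists k; split; [lia | exact H].
Qed.

(** * The walk operator and its effect on alternating chains *)

Definition signed (q : nat -> R) (h : nat) : R := (-1) ^ h * q h.

Section Walk.
Variables a b : nat -> R.

Definition push (q : nat -> R) (h : nat) : R :=
  match h with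
  | O => 0
  | S O => a 0 * q 0%nat
  | S (S k as h') => a h' * q h' + b k * q k
  end.

Hypothesis apos : forall h, 0 < a h.
Hypothesis bpos : forall h, 0 < b h.

Lemma signed_push_1 q : signed (push q) 1 = - (a 0 * signed q 0).
Proof. unfold signed; simpl; ring. Qed.

(** On signed sequences the operator is a weighted difference. Hence the last point of a positive
    run produces a positive value two places further, and the first point of such a run a negative
    value one place further. *)
Lemma signed_push_SS q k : signed (push q) (S (S k)) = b k * signed q k - a (S k) * signed q (S k).
Proof. unfold signed; simpl; ring. Qed.

(** Each element of the chain yields one of the same sign, two places after the end of its run. The
    order is kept, since the next element has the opposite sign and so lies at or beyond the first
    nonpositive position. *)
Lemma alt_push_tail q B : (forall k, (B < k)%nat -> q k = 0) -> forall l sg h,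
  0 < sg * signed q h -> alt (signed q) l (- sg) (S h) ->
  alt (signed (push q)) (S l) sg (S (S h)).
Proof.
  intros HB; assert (HBs : forall k, (B < k)%nat -> signed q k = 0)
    by (intros k Hk; unfold signed; rewrite HB by auto; ring).
  induction l as [|l IH]; intros sg h Hh H;
    destruct (first_nonpositive _ sg B h HBs Hh) as [k [Hk1 [Hk2 [Hk3 Hk4]]]];
    (destruct k as [|k]; [lia|]); simpl in Hk3.
  all: exists (S (S k)); split; [lia|]; split;
    [rewrite signed_push_SS; pose proof (apos (S k)); pose proof (bpos k);
     assert (0 < b k * (sg * signed q k)) by (apply Rmult_lt_0_compat; auto);
     assert (a (S k) * (sg * signed q (S k)) <= 0) by nra; lra|].
  - exact I.
  - destruct H as [h2 [Hh2 [Hs2 H]]].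
    apply (alt_start _ _ _ (S (S h2))).
    + assert (S k <= h2)%nat; [|lia].
      apply Hk4; [lia|]. lra.
    + apply IH; auto.
Qed.

(** The additional element comes from the beginning of the first run, which produces the sign [- sg]
    before all the elements of [alt_push_tail]. *)
Lemma alt_push q B l sg h : (forall k, (B < k)%nat -> q k = 0) ->
  alt (signed q) (S l) sg h -> alt (signed (push q)) (S (S l)) (- sg) 0.
Proof.
  intros HB [k1 [_ [Hs H]]].
  destruct (positive_run_start _ _ _ Hs) as [k0 [Hk0 [Hp Hstart]]].
  exists (S k0); split; [lia|]; split.
  - destruct k0 as [|k0].
    + rewrite signed_push_1; pose proof (apos 0); nra.
    + destruct Hstart as [Hst|Hst]; [lia|]; simpl in Hst.
      rewrite signed_push_SS; pose proof (apos (S k0)); pose proof (bpos k0).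
      assert (0 < a (S k0) * (sg * signed q (S k0))) by (apply Rmult_lt_0_compat; auto).
      assert (b k0 * (sg * signed q k0) <= 0) by nra. lra.
  - rewrite Ropp_involutive.
    apply (alt_start _ _ _ (S (S k1))); [lia|].
    apply (alt_push_tail q B); auto.
Qed.

Fixpoint walk (s i x : nat) : R :=
  match s with
  | O => if (i =? x)%nat then 1 else 0
  | S s' => a i * walk s' (S i) x + b i * walk s' (S (S i)) x
  end.

Lemma push_ext q q' h : (forall k, q k = q' k) -> push q h = push q' h.
Proof. intros E; destruct h as [|[|h]]; simpl; rewrite ?E; reflexivity. Qed.

Lemma push_lin c c' q q' h : push (fun k => c * q k + c' * q' k) h = c * push q h + c' * push q' h.
Proof. destruct h as [|[|h]]; simpl; ring. Qed.

(** [walk] is defined by its first step, which the recurrence over a period uses; the sweep needs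
    the decomposition by the last step. *)
Lemma walk_push s : forall i x, walk (S s) i x = push (walk s i) x.
Proof.
  induction s as [|s IH]; intros i x.
  - destruct x as [|[|x]]; simpl.
    + ring.
    + destruct i as [|i]; simpl; ring.
    + destruct (Nat.eqb_spec i (S x)), (Nat.eqb_spec i x); subst; try lia; ring.
  - change (walk (S (S s)) i x) with (a i * walk (S s) (S i) x + b i * walk (S s) (S (S i)) x).
    rewrite !IH, <- push_lin. apply push_ext; reflexivity.
Qed.

Lemma walk_bounded s : forall i x, (i + 2 * s < x)%nat -> walk s i x = 0.
Proof.
  induction s as [|s IH]; intros i x Hx; simpl.
  - destruct (Nat.eqb_spec i x); [lia | reflexivity].
  - rewrite !IH by lia; ring.
Qed.

Lemma walk_mass (ab1 : forall h, a h + b h = 1) s : forall i X, (i + 2 * s < X)%nat ->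
  lsum (walk s i) (seq 0 X) = 1.
Proof.
  induction s as [|s IH]; intros i X HX.
  - replace (seq 0 X) with (seq 0 i ++ i :: seq (S i) (X - S i)).
    + rewrite lsum_app; cbn [lsum walk]. rewrite Nat.eqb_refl.
      rewrite !lsum_zero; [ring| |]; intros y Hy; apply in_seq in Hy;
        destruct (Nat.eqb_spec i y); auto; lia.
    + change (i :: seq (S i) (X - S i)) with (seq (0 + i) (S (X - S i))).
      rewrite <- seq_app; f_equal; lia.
  - cbn [walk]. rewrite lsum_plus, !lsum_scal, !IH by lia.
    specialize (ab1 i); lra.
Qed.

(** * The sweep *)

(** A triple of time [w], position and coefficient stands for a multiple of [M^w] applied to a point
    mass. *)
Definition term : Type := nat * nat * R.
Definition t_time (t : term) := fst (fst t).
Definition t_pos (t : term) := snd (fst t).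
Definition t_coef (t : term) := snd t.

(** The partial sum over the times at least [j], with [M^j] divided out; [tailsum T 0] is the whole
    combination. *)
Definition tailsum (T : list term) (j x : nat) : R :=
  lsum (fun t => if (j <=? t_time t)%nat then t_coef t * walk (t_time t - j) (t_pos t) x else 0) T.

Definition row (T : list term) (j x : nat) : R :=
  lsum (fun t => if (t_time t =? j)%nat then t_coef t * walk 0 (t_pos t) x else 0) T.

Definition count (f : term -> bool) (T : list term) : nat := length (filter f T).

(** Horner's scheme in the operator [M]: one application of [M], then the point masses of time
    [j]. *)
Lemma tailsum_step T j x : tailsum T j x = push (tailsum T (S j)) x + row T j x.
Proof.
  unfold tailsum, row. induction T as [|t T IH]; cbn [lsum].
  - destruct x as [|[|x]]; cbn [push]; ring.
  - rewrite IH.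
    set (Y := fun x0 => lsum _ T) in *.
    assert (E : push (fun x0 => (if (S j <=? t_time t)%nat
                 then t_coef t * walk (t_time t - S j) (t_pos t) x0 else 0) + Y x0) x
              = (if (S j <=? t_time t)%nat then t_coef t * push (walk (t_time t - S j) (t_pos t)) x else 0)
                + push Y x).
    { destruct (S j <=? t_time t)%nat; destruct x as [|[|x]]; cbn [push]; ring. }
    unfold Y in E at 1; unfold Y; rewrite E. fold Y.
    destruct (Nat.leb_spec j (t_time t)) as [Hj|Hj].
    + destruct (Nat.eqb_spec (t_time t) j) as [Ej|Ej].
      * destruct (Nat.leb_spec (S j) (t_time t)); [lia|].
        replace (t_time t - j)%nat with 0%nat by lia. unfold Y; ring.
      * destruct (Nat.leb_spec (S j) (t_time t)); [|lia].
        replace (t_time t - j)%nat with (S (t_time t - S j)) by lia.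
        rewrite walk_push. unfold Y; ring.
    + destruct (Nat.eqb_spec (t_time t) j); [lia|].
      destruct (Nat.leb_spec (S j) (t_time t)); [lia|]. unfold Y; ring.
Qed.

(** A point mass changes the sequence in one place, so [alt_change_one] applies once per mass. The
    subtraction is truncated: too many masses leave the empty chain. *)
Lemma alt_add_row T j q : forall l sg h, alt (signed q) l sg h ->
  alt (signed (fun x => q x + row T j x)) (l - 2 * count (fun t => t_time t =? j)%nat T) sg h.
Proof.
  unfold count; induction T as [|t T IH]; intros l sg h H.
  - cbn [filter length]. replace (l - 2 * 0)%nat with l by lia.
    revert H; apply alt_ext; intros k; unfold signed, row; cbn [lsum]; ring.
  - specialize (IH l sg h H). cbn [filter].
    destruct (Nat.eqb_spec (t_time t) j) as [E|E].
    + cbn [length].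
      match goal with |- alt _ (l - 2 * S ?c) _ _ =>
        replace (l - 2 * S c)%nat with (l - 2 * c - 2)%nat by lia end.
      revert IH; apply (alt_change_one _ _ (t_pos t)).
      intros k Hk; unfold signed, row; cbn [lsum].
      destruct (Nat.eqb_spec (t_time t) j); [|lia].
      cbn [walk]; destruct (Nat.eqb_spec (t_pos t) k); [congruence | ring].
    + revert IH; apply alt_ext; intros k; unfold signed, row; cbn [lsum].
      destruct (Nat.eqb_spec (t_time t) j); [lia | ring].
Qed.

Lemma tailsum_bounded T j : exists X, forall x, (X < x)%nat -> tailsum T j x = 0.
Proof.
  unfold tailsum; induction T as [|t T [X HX]]; [exists 0%nat; reflexivity|].
  exists (X + t_pos t + 2 * t_time t)%nat; intros x Hx; cbn [lsum].
  rewrite HX by lia. destruct (j <=? t_time t)%nat; [rewrite walk_bounded by lia|]; ring.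
Qed.

Lemma tailsum_mass (ab1 : forall h, a h + b h = 1) T j : exists X,
  lsum (tailsum T j) (seq 0 X) = lsum (fun t => if (j <=? t_time t)%nat then t_coef t else 0) T.
Proof.
  assert (H : exists X, forall t, In t T -> (t_pos t + 2 * t_time t < X)%nat).
  { induction T as [|t T [X HX]]; [exists 0%nat; intros t []|].
    exists (X + S (t_pos t + 2 * t_time t))%nat.
    intros t' [<-|Ht]; [lia | specialize (HX t' Ht); lia]. }
  destruct H as [X HX]; exists X; unfold tailsum.
  rewrite lsum_swap; apply lsum_ext; intros t Ht; specialize (HX t Ht).
  destruct (j <=? t_time t)%nat.
  - rewrite lsum_scal, walk_mass by (auto; lia); ring.
  - apply lsum_zero; reflexivity.
Qed.

Lemma nonzero_alt (q : nat -> R) x : q x <> 0 -> exists sg, alt (signed q) 1 sg 0.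
Proof.
  intros Hq; exists (signed q x); exists x; repeat split; [lia|].
  assert (signed q x <> 0).
  { unfold signed; apply Rmult_integral_contrapositive_currified; auto; apply pow_nonzero; lra. }
  nra.
Qed.

Lemma alt_nonzero (q : nat -> R) l sg h : alt (signed q) (S l) sg h -> exists x, q x <> 0.
Proof.
  intros [k [_ [Hs _]]]; exists k; intros E; unfold signed in Hs; rewrite E in Hs; lra.
Qed.

Lemma count_split f g h T : (forall t, In t T -> (f t = true <-> g t = true \/ h t = true) /\
   ~ (g t = true /\ h t = true)) -> count f T = (count g T + count h T)%nat.
Proof.
  unfold count; induction T as [|t T IH]; intros H; [reflexivity|]; cbn [filter].
  specialize (IH ltac:(intros t' Ht'; apply H; right; exact Ht')).
  destruct (H t (or_introl eq_refl)) as [H1 H2].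
  destruct (f t), (g t), (h t); cbn [length]; try lia; exfalso; intuition congruence.
Qed.

(** The chain starts with length one at time [Om], gains one per unit of time and loses at most two
    per point mass. If the losses could exhaust it, the nonzero total mass supplies a new chain of
    length one. At time [lo] the remaining masses must cancel what is left. *)
Lemma sweep (T : list term) (lo Om : nat) :
  (forall h, a h + b h = 1) -> (lo < Om)%nat ->
  (forall t, In t T -> lo <= t_time t <= Om)%nat ->
  (forall x, tailsum T 0 x = 0) ->
  (forall j, (lo < j <= Om)%nat ->
     lsum (fun t => if (j <=? t_time t)%nat then t_coef t else 0) T <> 0) ->
  (Om - lo + 5 <= 2 * length T)%nat.
Proof.
  intros ab1 Hlo Hrange Htot Hgen.
  assert (Hnz : forall j, (lo < j <= Om)%nat -> exists x, tailsum T j x <> 0).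
  { intros j Hj; apply not_all_ex_not; intros H; apply (Hgen j Hj).
    destruct (tailsum_mass ab1 T j) as [X <-]; apply lsum_zero; auto. }
  (* The masses at time [Om] are left out: they create the initial chain and cost it nothing. *)
  set (cnt := fun j => count (fun t => andb (j <=? t_time t)%nat (t_time t <? Om)%nat) T).
  assert (Hchain : forall t j, (j + t = Om)%nat -> (lo < j)%nat ->
            exists l sg, (1 <= l)%nat /\ (t + 1 <= l + 2 * cnt j)%nat /\ alt (signed (tailsum T j)) l sg 0).
  { induction t as [|t IH]; intros j Hj Hl.
    - destruct (Hnz j) as [x Hx]; [lia|].
      destruct (nonzero_alt _ _ Hx) as [sg H]; exists 1%nat, sg; repeat split; auto; lia.
    - destruct (IH (S j)) as [l [sg [Hl1 [Hl2 H]]]]; [lia|lia|].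
      destruct l as [|l]; [lia|].
      destruct (tailsum_bounded T (S j)) as [X HX].
      apply (alt_push _ X _ _ _ HX) in H.
      apply (alt_add_row T j) in H.
      assert (Hc : cnt j = (cnt (S j) + count (fun t => t_time t =? j)%nat T)%nat).
      { apply count_split; intros u _.
        rewrite !Bool.andb_true_iff, !Nat.leb_le, !Nat.ltb_lt, Nat.eqb_eq; lia. }
      set (c := count (fun t => t_time t =? j)%nat T) in *.
      destruct (Nat.le_gt_cases 1 (S (S l) - 2 * c)) as [Hc1|Hc1].
      + exists (S (S l) - 2 * c)%nat, (- sg); repeat split; auto; [lia|].
        revert H; apply alt_ext; intros k; unfold signed; rewrite (tailsum_step T j); reflexivity.
      + destruct (Hnz j) as [x Hx]; [lia|].
        destruct (nonzero_alt _ _ Hx) as [sg' H']; exists 1%nat, sg'; repeat split; auto; lia. }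
  (* Below [lo] no mass is added and [M] keeps a nonzero sequence nonzero, so the sum can vanish at
     time 0 only if it vanishes at [lo] already. *)
  assert (Hlow : forall x, tailsum T lo x = 0).
  { assert (Hdown : forall j, (j <= lo)%nat -> (exists x, tailsum T j x <> 0) -> exists x, tailsum T 0 x <> 0).
    { induction j as [|j IH]; intros Hj Hx; auto.
      apply IH; [lia|]. destruct Hx as [x Hx].
      destruct (nonzero_alt _ _ Hx) as [sg H].
      destruct (tailsum_bounded T (S j)) as [X HX].
      apply (alt_push _ X _ _ _ HX), alt_nonzero in H. destruct H as [y Hy]; exists y.
      rewrite tailsum_step. unfold row; rewrite lsum_zero; [lra|].
      intros t Ht; specialize (Hrange t Ht); destruct (Nat.eqb_spec (t_time t) j); [lia | reflexivity]. }
    intros x; destruct (Req_dec (tailsum T lo x) 0) as [E|E]; auto.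
    destruct (Hdown lo (le_n _) (ex_intro _ x E)) as [y Hy]; destruct (Hy (Htot y)). }
  destruct (Hchain (Om - S lo)%nat (S lo)) as [l [sg [Hl1 [Hl2 H]]]]; [lia|lia|].
  destruct l as [|l]; [lia|].
  destruct (tailsum_bounded T (S lo)) as [X HX].
  apply (alt_push _ X _ _ _ HX) in H.
  set (cl := count (fun t => t_time t =? lo)%nat T).
  (* The masses at time [lo] cancel the pushed sequence completely, so they meet every point of its
     chain. *)
  assert (Hcl : (S (S l) <= cl)%nat).
  { set (F := map t_pos (filter (fun t => t_time t =? lo)%nat T)).
    apply (alt_support _ F) in H.
    - apply (Nat.le_trans _ _ _ H).
      apply (Nat.le_trans _ (length F)); [apply filter_length_le|].
      unfold F; rewrite length_map; apply le_n.
    - intros k Hk.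
      assert (Hr : row T lo k <> 0).
      { intros E; apply Hk; unfold signed.
        specialize (Hlow k); rewrite tailsum_step, E, Rplus_0_r in Hlow; rewrite Hlow; ring. }
      destruct (in_dec Nat.eq_dec k F) as [Hin|Hin]; auto.
      exfalso; apply Hr; unfold row; apply lsum_zero; intros t Ht.
      destruct (Nat.eqb_spec (t_time t) lo) as [E|E]; auto.
      cbn [walk]; destruct (Nat.eqb_spec (t_pos t) k) as [E'|E']; [|ring].
      exfalso; apply Hin; unfold F; rewrite <- E'; apply in_map, filter_In.
      split; auto; now apply Nat.eqb_eq. }
  assert (Htop : (1 <= count (fun t => t_time t =? Om)%nat T)%nat).
  { destruct (Nat.le_gt_cases 1 (count (fun t => t_time t =? Om)%nat T)) as [|Hc]; auto.
    exfalso; apply (Hgen Om); [lia|]. apply lsum_zero; intros t Ht.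
    destruct (Nat.leb_spec Om (t_time t)) as [Hle|]; auto.
    exfalso. assert (Hin : In t (filter (fun t => t_time t =? Om)%nat T)).
    { apply filter_In; split; auto; apply Nat.eqb_eq; specialize (Hrange t Ht); lia. }
    unfold count in Hc; destruct (filter (fun t => t_time t =? Om)%nat T); [destruct Hin | simpl in Hc; lia]. }
  assert (Hall : length T = (cnt (S lo) + cl + count (fun t => t_time t =? Om)%nat T)%nat).
  { assert (E1 : length T = count (fun _ => true) T).
    { unfold count; f_equal; clear; induction T as [|t T IH]; simpl; congruence. }
    rewrite E1.
    rewrite (count_split _ (fun t => t_time t <? Om)%nat (fun t => t_time t =? Om)%nat).
    - f_equal. apply count_split; intros t Ht; specialize (Hrange t Ht).
      rewrite !Bool.andb_true_iff, !Nat.leb_le, !Nat.ltb_lt, Nat.eqb_eq; lia.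
    - intros t Ht; specialize (Hrange t Ht).
      rewrite Nat.ltb_lt, Nat.eqb_eq; split; [|lia].
      split; [lia | auto]. }
  (* Let L be the chain length at [S lo], so that [Om - lo] is at most L + 2 [cnt (S lo)]. At least
     L + 1 masses lie at [lo] and one at [Om]; the surplus 2(L + 1) + 2 - L is at least 5 because L
     is at least 1. *)
  lia.
Qed.

End Walk.

(** * The recurrence of a periodic walk over one period *)

(** The linear functional sending [t^k] to [f k]. Lists are polynomials in [t], and [t] will act as
    a unit shift of time. *)
Fixpoint pe (p : list R) (f : nat -> R) : R :=
  match p with [] => 0 | c :: p' => c * f 0%nat + pe p' (fun k => f (S k)) end.

Fixpoint padd (p q : list R) : list R :=
  match p, q with
  | [], _ => q
  | _, [] => p
  | x :: p', y :: q' => (x + y) :: padd p' q'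
  end.

Definition pscal (c : R) (p : list R) : list R := map (Rmult c) p.

Lemma pe_ext p : forall f g, (forall k, f k = g k) -> pe p f = pe p g.
Proof.
  induction p as [|c p IH]; intros f g H; simpl; [reflexivity|].
  rewrite H; f_equal; apply IH; intros; apply H.
Qed.

Lemma pe_padd p : forall q f, pe (padd p q) f = pe p f + pe q f.
Proof.
  induction p as [|c p IH]; intros [|c' q] f; simpl; try ring. rewrite IH; ring.
Qed.

Lemma pe_pscal c p : forall f, pe (pscal c p) f = c * pe p f.
Proof. induction p as [|x p IH]; intros f; simpl; [ring|]. unfold pscal in IH; rewrite IH; ring. Qed.

Lemma pe_lin p c c' : forall f g, pe p (fun k => c * f k + c' * g k) = c * pe p f + c' * pe p g.
Proof.
  induction p as [|x p IH]; intros f g; simpl; [ring|].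
  rewrite (IH (fun k => f (S k)) (fun k => g (S k))); ring.
Qed.

Lemma nth_padd p : forall q s, nth s (padd p q) 0 = nth s p 0 + nth s q 0.
Proof.
  induction p as [|c p IH]; intros [|c' q] [|s]; simpl; try ring. apply IH.
Qed.

Lemma nth_pscal c p : forall s, nth s (pscal c p) 0 = c * nth s p 0.
Proof. induction p as [|x p IH]; intros [|s]; simpl; try ring. apply IH. Qed.

Lemma length_padd p : forall q, length (padd p q) = Nat.max (length p) (length q).
Proof. induction p as [|c p IH]; intros [|c' q]; simpl; auto. Qed.

Section Continuants.
Variables a b : nat -> R.

(* [contp off i] is the pair of continuants (A_i, A_{i-1}), A_{i+1} = a_i A_i + t b_{i-1} A_{i-1},
   as coefficient lists in t, for the weights shifted by [off]. *)
Fixpoint contp (off i : nat) : list R * list R :=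
  match i with
  | O => ([1], [])
  | S j => (padd (pscal (a (off + j)%nat) (fst (contp off j)))
                 (0 :: pscal (b (off + j - 1)%nat) (snd (contp off j))), fst (contp off j))
  end.

Fixpoint bprod (off i : nat) : R :=
  match i with O => 1 | S j => bprod off j * b (off + j)%nat end.

Lemma contp_length off i :
  length (fst (contp off i)) = S (i / 2) /\ length (snd (contp off i)) = (S i / 2)%nat.
Proof.
  induction i as [|i [IH1 IH2]]; [split; reflexivity|]; cbn [contp fst snd]; split.
  - rewrite length_padd; cbn [length]; unfold pscal; rewrite !length_map, IH1, IH2.
    assert (i / 2 <= S i / 2)%nat by (apply Nat.Div0.div_le_mono; lia). lia.
  - rewrite IH1. replace (S (S i)) with (i + 1 * 2)%nat by lia. rewrite Nat.div_add; lia.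
Qed.

Variable D : nat.
Hypothesis aper : forall h, a (h + D)%nat = a h.
Hypothesis bper : forall h, b (h + D)%nat = b h.

Lemma contp_shift off i : contp (off + D) i = contp off i.
Proof.
  induction i as [|i IH]; [reflexivity|]; cbn [contp]; rewrite IH.
  replace (off + D + i)%nat with (off + i + D)%nat by lia. rewrite aper.
  destruct i as [|i]; [reflexivity|].
  replace (off + S i + D - 1)%nat with (off + S i - 1 + D)%nat by lia. rewrite bper; reflexivity.
Qed.

Lemma contp_periodic m off i : contp (off + m * D) i = contp off i.
Proof.
  induction m as [|m IH]; [now replace (off + 0 * D)%nat with off by lia|].
  replace (off + S m * D)%nat with (off + m * D + D)%nat by lia.
  now rewrite contp_shift.
Qed.

Lemma b_periodic m h : b (h + m * D)%nat = b h.
Proof.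
  induction m as [|m IH]; [f_equal; lia|].
  replace (h + S m * D)%nat with (h + m * D + D)%nat by lia. now rewrite bper.
Qed.

Lemma bprod_periodic m off i : bprod (off + m * D) i = bprod off i.
Proof.
  induction i as [|i IH]; [reflexivity|]; cbn [bprod]; rewrite IH.
  replace (off + m * D + i)%nat with (off + i + m * D)%nat by lia. now rewrite b_periodic.
Qed.

Variable u : nat -> nat -> R.
Hypothesis urec : forall s i, u (S s) i = a i * u s (S i) + b i * u s (S (S i)).

(** [A_i] is the weighted sum over the tilings of [i] consecutive heights by steps of length one and
    two. A step of length two covers two heights in one unit of time, and the power of [t] records
    the time thus saved. At [i = 0] the second continuant is empty, so the truncated index does no
    harm. *)
Lemma first_steps i : forall s off, u (s + i)%nat off =
  pe (fst (contp off i)) (fun k => u (s + k)%nat (off + i)%nat)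
  + b (off + i - 1)%nat * pe (snd (contp off i)) (fun k => u (s + k)%nat (S (off + i))).
Proof.
  induction i as [|i IH]; intros s off.
  - cbn [contp fst snd pe]. rewrite !Nat.add_0_r; ring.
  - replace (s + S i)%nat with (S s + i)%nat by lia. rewrite IH; cbn [contp fst snd].
    rewrite pe_padd, pe_pscal; cbn [pe]; rewrite pe_pscal.
    rewrite (pe_ext _ _ (fun k => a (off + i)%nat * u (s + k)%nat (S (off + i))
       + b (off + i)%nat * u (s + k)%nat (S (S (off + i)))))
      by (intros k; apply urec).
    rewrite pe_lin.
    rewrite (pe_ext (snd (contp off i)) (fun k => u (S s + k)%nat (S (off + i)))
              (fun k => u (s + S k)%nat (S (off + i))))
      by (intros k; f_equal; lia).
    replace (off + S i - 1)%nat with (off + i)%nat by lia.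
    replace (off + S i)%nat with (S (off + i)) by lia. ring.
Qed.

(** The recurrence is solved for the value at the greatest height and iterated upwards. It has
    second order, so the induction carries two consecutive indices. *)
Lemma eliminate_far i : forall off s,
  (bprod off i * u s (S (off + i)) =
    (-1) ^ i * (pe (fst (contp off i)) (fun k => u (s + k)%nat (S off))
                - pe (snd (contp (S off) i)) (fun k => u (s + S k)%nat off))) /\
  (bprod off (S i) * u s (S (off + S i)) =
    (-1) ^ (S i) * (pe (fst (contp off (S i))) (fun k => u (s + k)%nat (S off))
                - pe (snd (contp (S off) (S i))) (fun k => u (s + S k)%nat off))).
Proof.
  induction i as [|i IH]; intros off s.
  - cbn [contp fst snd pe pscal map bprod padd]. rewrite !Nat.add_0_r.
    replace (s + 1)%nat with (S s) by lia. replace (off + 1)%nat with (S off) by lia.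
    rewrite urec. simpl; split; ring.
  - destruct (IH off s) as [_ IH2]; destruct (IH off (S s)) as [IH1 _]; split; [exact IH2|].
    assert (E : bprod off (S (S i)) * u s (S (off + S (S i))) =
       b (off + i)%nat * (bprod off i * u (S s) (S (off + i)))
       - a (off + S i)%nat * (bprod off (S i) * u s (S (off + S i)))).
    { rewrite urec; cbn [bprod].
      replace (off + S (S i))%nat with (S (S (off + i))) by lia.
      replace (off + S i)%nat with (S (off + i)) by lia. ring. }
    rewrite E, IH1, IH2.
    set (p := contp off (S i)); set (q := contp (S off) (S i)).
    change (fst (contp off (S (S i)))) with
      (padd (pscal (a (off + S i)%nat) (fst p)) (0 :: pscal (b (off + S i - 1)%nat) (snd p))).
    change (snd (contp (S off) (S (S i)))) with (fst q).
    unfold q; cbn [contp fst snd].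
    change (snd p) with (fst (contp off i)).
    rewrite !pe_padd, !pe_pscal; cbn [pe]; rewrite !pe_pscal.
    replace (S off + i - 1)%nat with (off + i)%nat by lia.
    replace (off + S i - 1)%nat with (off + i)%nat by lia.
    replace (off + S i)%nat with (S off + i)%nat by lia.
    rewrite (pe_ext (fst (contp off i)) (fun k => u (S s + k)%nat (S off)) (fun k => u (s + S k)%nat (S off)))
      by (intros k; f_equal; lia).
    rewrite (pe_ext (snd (contp (S off) i)) (fun k => u (S s + S k)%nat off) (fun k => u (s + S (S k))%nat off))
      by (intros k; f_equal; lia).
    cbn [pow]; ring.
Qed.

(** The cyclic continuant: weighted tilings of a cycle of [D] heights, the second summand collecting
    those in which a step of length two crosses the seam. *)
Definition period_coefs : list R :=
  padd (fst (contp 0 D)) (0 :: pscal (b (D - 1)%nat) (snd (contp 1 (D - 1)))).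

(** Besides the height [S m * D], [first_steps] leaves a term just above it with the factor
    [A_{D-1}]; [eliminate_far] over [D - 1] heights contains the same term and removes it. As
    [D - 1] is even, the elimination has sign plus and no negative coefficient appears. *)
Lemma period_recurrence r m s : D = (2 * r + 1)%nat ->
  u (s + D)%nat (m * D)%nat =
    pe period_coefs (fun k => u (s + k)%nat (S m * D)%nat) + bprod 0 D * u s (S (S m) * D)%nat.
Proof.
  intros HD. unfold period_coefs. rewrite pe_padd; cbn [pe]; rewrite pe_pscal.
  rewrite first_steps.
  destruct (eliminate_far (2 * r) (S m * D)%nat s) as [G _].
  rewrite pow_mult in G. replace ((-1) ^ 2) with 1 in G by ring. rewrite pow1 in G.
  pose proof (contp_periodic m 0 D) as E1. pose proof (contp_periodic (S m) 0 (2 * r)) as E2.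
  pose proof (contp_periodic (S m) 1 (2 * r)) as E3. pose proof (bprod_periodic (S m) 0 (2 * r)) as E4.
  change (0 + m * D)%nat with (m * D)%nat in E1.
  change (0 + S m * D)%nat with (S m * D)%nat in E2, E4.
  change (1 + S m * D)%nat with (S (S m * D)) in E3.
  rewrite E1. rewrite E2, E3, E4 in G.
  assert (HD' : D = S (2 * r)) by lia.
  assert (E5 : b (m * D + D - 1)%nat = b (2 * r)%nat).
  { replace (m * D + D - 1)%nat with (2 * r + m * D)%nat by lia. apply b_periodic. }
  rewrite E5.
  assert (E6 : bprod 0 D = bprod 0 (2 * r) * b (2 * r)%nat) by (rewrite HD' at 1; reflexivity).
  assert (E7 : snd (contp 0 D) = fst (contp 0 (2 * r))) by (rewrite HD' at 1; reflexivity).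
  rewrite E6, E7. replace (D - 1)%nat with (2 * r)%nat by lia.
  replace (m * D + D)%nat with (S m * D)%nat by lia.
  replace (S (S m) * D)%nat with (S (S m * D + 2 * r)) by lia.
  rewrite (Rmult_comm (bprod 0 (2 * r))), Rmult_assoc, G. ring.
Qed.

Lemma period_coefs_length r : D = (2 * r + 1)%nat -> length period_coefs = S r.
Proof.
  intros HD. unfold period_coefs. rewrite length_padd; cbn [length]; unfold pscal; rewrite length_map.
  destruct (contp_length 0 D) as [-> _]; destruct (contp_length 1 (D - 1)) as [_ ->].
  replace (S (D - 1)) with D by lia.
  replace (D / 2)%nat with r; [lia|]. rewrite HD, Nat.mul_comm, Nat.div_add_l; simpl; lia.
Qed.

End Continuants.

(** * Weights of separated orders of magnitude *)

(** Heights [2s] and [2s + 1] share the exponent [(B - 1) * B^s]. Steps of length two from the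
    heights 0, 2, ..., [2k - 2] then have total exponent [B^k - 1], which is [theta B k], the least
    possible for [k] disjoint ones within a period. *)
Definition expo (B i : nat) : nat := ((B - 1) * B ^ (i / 2))%nat.
Definition wb (B D : nat) (eps : R) (h : nat) : R := eps ^ expo B (h mod D).
Definition wa (B D : nat) (eps : R) (h : nat) : R := 1 - wb B D eps h.
Definition theta (B k : nat) : nat := (B ^ k - 1)%nat.

Lemma pow_small eps n m : 0 < eps <= 1 -> (n <= m)%nat -> eps ^ m <= eps ^ n.
Proof.
  intros He Hn. replace m with (n + (m - n))%nat by lia. rewrite pow_add.
  assert (0 < eps ^ n) by (apply pow_lt; lra).
  assert (eps ^ (m - n) <= 1) by (rewrite <- (pow1 (m - n)); apply pow_incr; lra).
  nra.
Qed.

Section Asymptotics.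
Variable B : nat.
Hypothesis B2 : (2 <= B)%nat.

Lemma B_pow_pos k : (1 <= B ^ k)%nat.
Proof. assert (B ^ k <> 0)%nat by (apply Nat.pow_nonzero; lia); lia. Qed.

Lemma expo_pos i : (1 <= expo B i)%nat.
Proof. unfold expo; pose proof (B_pow_pos (i / 2)); nia. Qed.

Lemma expo_mono i j : (i <= j)%nat -> (expo B i <= expo B j)%nat.
Proof.
  intros H; unfold expo; apply Nat.mul_le_mono_l, Nat.pow_le_mono_r; [lia|].
  apply Nat.Div0.div_le_mono, H.
Qed.

Lemma expo_theta s : (expo B (2 * s) + theta B s = theta B (S s))%nat.
Proof.
  unfold expo, theta. rewrite (Nat.mul_comm 2), Nat.div_mul by lia.
  pose proof (B_pow_pos s). rewrite Nat.pow_succ_r'. nia.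
Qed.

Lemma expo_total r : (fold_right plus 0 (map (expo B) (seq 0 (2 * r + 1))) + 2 = B ^ (r + 1) + B ^ r)%nat.
Proof.
  assert (Hadd : forall l x, fold_right plus 0%nat (l ++ [x]) = (fold_right plus 0 l + x)%nat)
    by (induction l as [|y l IHl]; intros; simpl; [lia|rewrite IHl; lia]).
  induction r as [|r IH].
  - unfold expo; simpl. lia.
  - replace (2 * S r + 1)%nat with (S (S (2 * r + 1))) by lia.
    rewrite !seq_S, !map_app; cbn [map]. rewrite !Hadd.
    unfold expo at 2 3.
    replace ((0 + (2 * r + 1)) / 2)%nat with r
      by (symmetry; replace (0 + (2 * r + 1))%nat with (1 + r * 2)%nat by lia; rewrite Nat.div_add; simpl; lia).
    replace ((0 + S (2 * r + 1)) / 2)%nat with (r + 1)%nat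
      by (symmetry; replace (0 + S (2 * r + 1))%nat with ((r + 1) * 2)%nat by lia; apply Nat.div_mul; lia).
    replace (S r + 1)%nat with (S (S r)) by lia. replace (r + 1)%nat with (S r) in * by lia.
    rewrite !Nat.pow_succ_r' in *. pose proof (B_pow_pos r). nia.
Qed.

Variable D : nat.
Variable eps : R.
Hypothesis Dpos : (0 < D)%nat.
Hypothesis Heps : 0 < eps <= 1 / 2.

Let a := wa B D eps.
Let b := wb B D eps.

Lemma wb_pos h : 0 < b h.
Proof. apply pow_lt; lra. Qed.

Lemma wb_le h : b h <= 1 / 2.
Proof.
  unfold b, wb. eapply Rle_trans; [apply (pow_small _ 1); [lra|apply expo_pos]|simpl; lra].
Qed.

Lemma wa_pos h : 0 < a h.
Proof. unfold a, wa; pose proof (wb_le h); unfold b in *; lra. Qed.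

Lemma wa_range h : 1 / 2 <= a h <= 1.
Proof. unfold a, wa; pose proof (wb_le h); pose proof (wb_pos h); unfold b in *; lra. Qed.

Lemma wab h : a h + b h = 1.
Proof. unfold a, b, wa; ring. Qed.

Lemma wb_period h : b (h + D)%nat = b h.
Proof.
  unfold b, wb. replace (h + D)%nat with (h + 1 * D)%nat by now rewrite Nat.mul_1_l. now rewrite Nat.Div0.mod_add.
Qed.

Lemma wa_period h : a (h + D)%nat = a h.
Proof. unfold a, wa; fold b; now rewrite wb_period. Qed.

(** Each step of the recursion at most doubles the bound. The condition [off + i <= D] keeps the
    heights that matter below the period, where [expo] is monotone. *)
Lemma contp_upper off i : (off + i <= D)%nat -> forall s,
  (0 <= nth s (fst (contp a b off i)) 0 <= 2 ^ i * eps ^ theta B s) /\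
  (0 <= nth s (snd (contp a b off i)) 0 <= 2 ^ i * eps ^ theta B s).
Proof.
  induction i as [|i IH]; intros Hi s.
  - cbn [contp fst snd]. assert (0 < eps ^ theta B s) by (apply pow_lt; lra).
    destruct s as [|[|s]]; cbn [nth]; rewrite pow_O, Rmult_1_l; try lra.
    change (theta B 0) with 0%nat in *; rewrite pow_O; lra.
  - assert (Hi' : (off + i <= D)%nat) by lia. specialize (IH Hi').
    assert (Hp : forall k, 0 < 2 ^ i * eps ^ theta B k)
      by (intros; apply Rmult_lt_0_compat; apply pow_lt; lra).
    cbn [contp fst snd]; split.
    2:{ destruct (IH s) as [H1 _]. specialize (Hp s). simpl pow at 1. lra. }
    rewrite nth_padd, nth_pscal.
    destruct (IH s) as [H1 _]. specialize (Hp s). pose proof (wa_range (off + i)%nat) as Ha.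
    assert (Hx : 0 <= a (off + i)%nat * nth s (fst (contp a b off i)) 0 <= 2 ^ i * eps ^ theta B s) by nra.
    assert (Hy : 0 <= nth s (0 :: pscal (b (off + i - 1)%nat) (snd (contp a b off i))) 0
                 <= 2 ^ i * eps ^ theta B s).
    { destruct s as [|s]; cbn [nth]; [lra|]. rewrite nth_pscal.
      destruct (Nat.lt_ge_cases s (length (snd (contp a b off i)))) as [Hl|Hl].
      2:{ rewrite nth_overflow by exact Hl. lra. }
      destruct (IH s) as [_ [H2 H3]]. pose proof (wb_pos (off + i - 1)%nat) as Hb.
      split; [apply Rmult_le_pos; lra|].
      destruct (contp_length a b off i) as [_ E]; rewrite E in Hl.
      (* The list has an entry at [s] only if [i] is at least [2s + 1]; the added step of length two
         therefore starts at height [2s] or above. *)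
      assert (Hs : (2 * s <= off + i - 1)%nat).
      { assert (2 * (S i / 2) <= S i)%nat by apply Nat.Div0.mul_div_le. lia. }
      assert (Hb2 : b (off + i - 1)%nat <= eps ^ expo B (2 * s)).
      { unfold b, wb; rewrite Nat.mod_small by lia. apply pow_small; [lra|]. now apply expo_mono. }
      rewrite <- (expo_theta s), pow_add.
      apply Rle_trans with (eps ^ expo B (2 * s) * (2 ^ i * eps ^ theta B s)).
      - apply Rmult_le_compat; lra.
      - lra. }
    simpl pow at 1. lra.
Qed.

(** One tiling suffices: steps of length two from 0, 2, ..., [2s - 2], then single steps, each of
    weight at least 1/2. *)
Lemma contp_lower i : (i <= D)%nat -> forall s,
  ((2 * s <= i)%nat -> (/ 2) ^ i * eps ^ theta B s <= nth s (fst (contp a b 0 i)) 0) /\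
  ((2 * s < i)%nat -> (/ 2) ^ i * eps ^ theta B s <= nth s (snd (contp a b 0 i)) 0).
Proof.
  induction i as [|i IH]; intros Hi s.
  - split; intros Hs; [|lia]. assert (s = 0%nat) by lia; subst s. simpl; lra.
  - specialize (IH ltac:(lia)).
    assert (Hp : forall k, 0 < (/ 2) ^ i * eps ^ theta B k)
      by (intros; apply Rmult_lt_0_compat; apply pow_lt; lra).
    cbn [contp fst snd]; split; intros Hs.
    2:{ destruct (IH s) as [H1 _]. specialize (Hp s). specialize (H1 ltac:(lia)). simpl pow at 1. lra. }
    rewrite nth_padd, nth_pscal.
    pose proof (wa_range (0 + i)%nat) as Ha.
    assert (Hu : 0 <= nth s (fst (contp a b 0 i)) 0) by (apply (contp_upper 0 i); lia).
    assert (Hv : 0 <= nth s (0 :: pscal (b (0 + i - 1)%nat) (snd (contp a b 0 i))) 0).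
    { destruct s as [|s']; cbn [nth]; [lra|]. rewrite nth_pscal. apply Rmult_le_pos.
      - pose proof (wb_pos (0 + i - 1)%nat); lra.
      - apply (contp_upper 0 i); lia. }
    destruct (Nat.le_gt_cases (2 * s) i) as [H|H].
    + destruct (IH s) as [H1 _]. specialize (H1 H). simpl pow at 1. specialize (Hp s). nra.
    + destruct s as [|s]; [lia|]. cbn [nth] in *. rewrite nth_pscal in *.
      destruct (IH s) as [_ H2]. specialize (H2 ltac:(lia)).
      (* Here [i = 2s + 1], so the tiling ends with a step of length two from height [2s]. *)
      assert (Hb : b (0 + i - 1)%nat = eps ^ expo B (2 * s)).
      { unfold b, wb; rewrite Nat.mod_small by lia. do 2 f_equal; lia. }
      rewrite Hb in *. rewrite <- (expo_theta s), pow_add.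
      assert (0 < eps ^ expo B (2 * s)) by (apply pow_lt; lra).
      assert (eps ^ expo B (2 * s) * ((/ 2) ^ i * eps ^ theta B s) <=
              eps ^ expo B (2 * s) * nth s (snd (contp a b 0 i)) 0) by (apply Rmult_le_compat_l; lra).
      assert (0 <= a (0 + i)%nat * nth (S s) (fst (contp a b 0 i)) 0) by (apply Rmult_le_pos; lra).
      specialize (Hp s).
      assert (0 < eps ^ expo B (2 * s) * ((/ 2) ^ i * eps ^ theta B s)) by (apply Rmult_lt_0_compat; lra).
      simpl pow at 1. lra.
Qed.

Lemma period_coefs_bounds r s : D = (2 * r + 1)%nat -> (s <= r)%nat ->
  (/ 2) ^ D * eps ^ theta B s <= nth s (period_coefs a b D) 0 <= 2 ^ (D + 1) * eps ^ theta B s.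
Proof.
  intros HD Hs. unfold period_coefs. rewrite nth_padd.
  destruct (contp_lower D ltac:(lia) s) as [HL _]. specialize (HL ltac:(lia)).
  destruct (contp_upper 0 D ltac:(lia) s) as [HU _].
  assert (Hpp : forall k, 0 < 2 ^ D * eps ^ theta B k)
      by (intros; apply Rmult_lt_0_compat; apply pow_lt; lra).
  assert (Hx : 0 <= nth s (0 :: pscal (b (D - 1)%nat) (snd (contp a b 1 (D - 1)))) 0
               <= 2 ^ D * eps ^ theta B s).
  { destruct s as [|s]; cbn [nth]; [specialize (Hpp 0%nat); lra|]. rewrite nth_pscal.
    destruct (contp_upper 1 (D - 1) ltac:(lia) s) as [_ [H2 H3]].
    pose proof (wb_pos (D - 1)%nat) as Hb.
    split; [apply Rmult_le_pos; lra|].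
    assert (Hb2 : b (D - 1)%nat <= eps ^ expo B (2 * s)).
    { unfold b, wb; rewrite Nat.mod_small by lia. apply pow_small; [lra|]. apply expo_mono; lia. }
    assert (H22 : 2 ^ (D - 1) <= 2 ^ D) by (apply Rle_pow; [lra|lia]).
    assert (0 < eps ^ theta B s) by (apply pow_lt; lra).
    assert (2 ^ (D - 1) * eps ^ theta B s <= 2 ^ D * eps ^ theta B s)
      by (apply Rmult_le_compat_r; lra).
    rewrite <- (expo_theta s), pow_add.
    apply Rle_trans with (eps ^ expo B (2 * s) * (2 ^ D * eps ^ theta B s)).
    - apply Rmult_le_compat; lra.
    - lra. }
  rewrite pow_add. simpl (2 ^ 1). lra.
Qed.

Lemma bprod_small i : (i <= D)%nat -> exists t, bprod b 0 i = eps ^ t /\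
  t = fold_right plus 0%nat (map (expo B) (seq 0 i)).
Proof.
  induction i as [|i IH]; intros Hi; [exists 0%nat; split; reflexivity|].
  destruct (IH ltac:(lia)) as [t [E1 E2]]. exists (t + expo B i)%nat; split.
  - cbn [bprod]. rewrite E1, pow_add. unfold b at 1, wb. rewrite Nat.mod_small by lia. reflexivity.
  - rewrite E2, seq_S, map_app, fold_right_app; simpl.
    generalize (map (expo B) (seq 0 i)); intros l; induction l as [|x l IHl]; simpl; lia.
Qed.

End Asymptotics.

(** * Dominant monomials *)

Fixpoint mval (xs : list R) (l : mono) : R :=
  match xs, l with x :: xs', e :: l' => x ^ e * mval xs' l' | _, _ => 1 end.

Fixpoint dot (w l : list nat) : nat :=
  match w, l with x :: w', e :: l' => (x * e + dot w' l')%nat | _, _ => 0%nat end.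

Definition ev (xs : list R) (L : mpoly) : R := lsum (fun p => snd p * mval xs (fst p)) L.

Lemma coef_cons p L m : coef (p :: L) m = (if mono_eq_dec (fst p) m then snd p else 0) + coef L m.
Proof. unfold coef; cbn [fold_right]; destruct (mono_eq_dec (fst p) m); ring. Qed.

Lemma coef_notin L m : ~ In m (map fst L) -> coef L m = 0.
Proof.
  induction L as [|p L IH]; intros H; [reflexivity|]. rewrite coef_cons.
  destruct (mono_eq_dec (fst p) m) as [E|E]; [destruct H; left; exact E|].
  rewrite IH; [ring | intros Hin; apply H; right; exact Hin].
Qed.

Lemma lsum_single {A} (dec : forall x y : A, {x = y} + {x <> y}) (x0 : A) (f : A -> R) M :
  NoDup M -> In x0 M -> lsum (fun x => if dec x0 x then f x else 0) M = f x0.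
Proof.
  induction M as [|x M IH]; intros Hnd Hin; [destruct Hin|]; inversion Hnd; subst; cbn [lsum].
  destruct (dec x0 x) as [->|Hx].
  - rewrite lsum_zero; [ring|]. intros y Hy; destruct (dec x y) as [->|]; [contradiction | reflexivity].
  - destruct Hin as [->|Hin]; [congruence|]. rewrite IH; auto; ring.
Qed.

(** A monomial may occur in several entries of a list; this passes from entries to total
    coefficients. *)
Lemma lsum_collect (phi : mono -> R) L M : NoDup M -> incl (map fst L) M ->
  lsum (fun p => snd p * phi (fst p)) L = lsum (fun m => coef L m * phi m) M.
Proof.
  intros Hnd; induction L as [|p L IH]; intros Hin; cbn [lsum].
  - symmetry; apply lsum_zero; intros; unfold coef; simpl; ring.
  - rewrite IH by (intros m Hm; apply Hin; right; exact Hm).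
    rewrite <- (lsum_single mono_eq_dec (fst p) (fun m => snd p * phi m) M Hnd) by (apply Hin; left; reflexivity).
    rewrite <- lsum_plus; apply lsum_ext; intros m _. rewrite coef_cons.
    destruct (mono_eq_dec (fst p) m); ring.
Qed.

Lemma exists_min {A} (f : A -> nat) (l : list A) : l <> [] ->
  exists x, In x l /\ forall y, In y l -> (f x <= f y)%nat.
Proof.
  induction l as [|x l IH]; intros H; [congruence|].
  destruct l as [|y l].
  - exists x; split; [left; reflexivity|]. intros y [<-|[]]; lia.
  - destruct (IH ltac:(discriminate)) as [z [Hz Hm]].
    destruct (Nat.le_gt_cases (f x) (f z)) as [Hc|Hc].
    + exists x; split; [left; reflexivity|]. intros t [<-|Ht]; [lia|specialize (Hm t Ht); lia].
    + exists z; split; [right; exact Hz|]. intros t [<-|Ht]; [lia|specialize (Hm t Ht); lia].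
Qed.

Definition of_order (k1 k2 eps : R) : list R -> list nat -> Prop :=
  Forall2 (fun c t => k1 * eps ^ t <= c <= k2 * eps ^ t).

Lemma mval_bounds k1 k2 eps C th : 0 < k1 -> 0 < eps -> of_order k1 k2 eps C th ->
  forall l, length l = length th ->
  0 < k1 ^ mdeg l * eps ^ dot th l /\
  k1 ^ mdeg l * eps ^ dot th l <= mval C l <= k2 ^ mdeg l * eps ^ dot th l.
Proof.
  intros Hk He H; induction H as [|c t C th Hc H IH]; intros [|e l] Hl; try discriminate.
  - simpl; lra.
  - cbn [mval dot mdeg fold_right]. injection Hl as Hl. destruct (IH l Hl) as [H0 [H1 H2]].
    fold (mdeg l). rewrite !pow_add, pow_mult.
    assert (Ht : 0 < k1 * eps ^ t) by (apply Rmult_lt_0_compat; auto; apply pow_lt; auto).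
    assert (Hp : (k1 * eps ^ t) ^ e <= c ^ e <= (k2 * eps ^ t) ^ e)
      by (split; apply pow_incr; lra).
    rewrite !Rpow_mult_distr in Hp.
    assert (Hq : 0 < k1 ^ e * (eps ^ t) ^ e)
      by (rewrite <- Rpow_mult_distr; apply pow_lt; auto).
    split.
    + assert (0 < k1 ^ e * (eps ^ t) ^ e * (k1 ^ mdeg l * eps ^ dot th l))
        by (apply Rmult_lt_0_compat; auto). lra.
    + split.
      * apply Rle_trans with ((k1 ^ e * (eps ^ t) ^ e) * (k1 ^ mdeg l * eps ^ dot th l)); [lra|].
        apply Rmult_le_compat; lra.
      * apply Rle_trans with ((k2 ^ e * (eps ^ t) ^ e) * (k2 ^ mdeg l * eps ^ dot th l)); [|lra].
        apply Rmult_le_compat; lra.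
Qed.

(** Distinct monomials of degree [d] have distinct weights, so among those present exactly one has
    least weight. Every other one carries at least one more factor [eps], which beats the constants
    [k1] and [k2] once [eps] is small. *)
Lemma ev_dominated (L : mpoly) (th : list nat) d k1 k2 m0 :
  0 < k1 -> 0 <= k2 ->
  (forall p, In p L -> length (fst p) = length th /\ mdeg (fst p) = d) ->
  (forall m m', length m = length th -> length m' = length th -> mdeg m = d -> mdeg m' = d ->
     dot th m = dot th m' -> m = m') ->
  coef L m0 <> 0 ->
  exists e0, 0 < e0 /\ forall eps C, 0 < eps <= 1 -> eps <= e0 -> of_order k1 k2 eps C th -> ev C L <> 0.
Proof.
  intros Hk1 Hk2 HL Hinj Hm0.
  set (M := nodup mono_eq_dec (map fst L)).
  assert (HM : NoDup M) by apply NoDup_nodup.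
  assert (HinM : forall m, In m M -> length m = length th /\ mdeg m = d).
  { intros m Hm; apply nodup_In, in_map_iff in Hm; destruct Hm as [p [<- Hp]]; auto. }
  assert (HcM : forall m, coef L m <> 0 -> In m M).
  { intros m Hm; apply nodup_In; destruct (in_dec mono_eq_dec m (map fst L)) as [|Hn]; auto.
    destruct (Hm (coef_notin _ _ Hn)). }
  set (nz := fun m => if Req_EM_T (coef L m) 0 then false else true).
  assert (Hnz : forall m, nz m = true <-> coef L m <> 0)
    by (intros m; unfold nz; destruct (Req_EM_T (coef L m) 0); split; congruence).
  destruct (exists_min (dot th) (filter nz M)) as [m1 [Hm1 Hmin]].
  { intros E. assert (Hin : In m0 (filter nz M)) by (apply filter_In; split; [auto | now apply Hnz]).
    rewrite E in Hin; destruct Hin. }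
  apply filter_In in Hm1; destruct Hm1 as [Hm1 Hc1]; apply Hnz in Hc1.
  destruct (in_split _ _ Hm1) as [M1 [M2 EM]].
  set (S0 := lsum (fun m => Rabs (coef L m)) (M1 ++ M2)).
  assert (HS0 : 0 <= S0).
  { rewrite <- (lsum_zero (fun _ : mono => 0) (M1 ++ M2)) by auto. apply lsum_le; intros; apply Rabs_pos. }
  assert (Hk2d : 0 <= k2 ^ d) by (apply pow_le; auto).
  assert (Hk1d : 0 < k1 ^ d) by (apply pow_lt; auto).
  assert (Hc1' : 0 < Rabs (coef L m1)) by (apply Rabs_pos_lt; auto).
  assert (Hnum : 0 < Rabs (coef L m1) * k1 ^ d) by (apply Rmult_lt_0_compat; auto).
  assert (Hden : 0 < S0 * k2 ^ d + 1) by (assert (0 <= S0 * k2 ^ d) by (apply Rmult_le_pos; auto); lra).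
  (* The summand 1 keeps the denominator positive and makes the final comparison strict. *)
  exists (Rabs (coef L m1) * k1 ^ d / (S0 * k2 ^ d + 1)); split.
  { apply Rdiv_lt_0_compat; auto. }
  intros eps C He He0 HC Hev.
  assert (HE : coef L m1 * mval C m1 = - lsum (fun m => coef L m * mval C m) (M1 ++ M2)).
  { unfold ev in Hev. rewrite (lsum_collect (mval C) L M) in Hev; auto.
    - rewrite EM, lsum_app in Hev; cbn [lsum] in Hev. rewrite lsum_app; lra.
    - intros m Hm; apply nodup_In; exact Hm. }
  assert (Hother : lsum (fun m => Rabs (coef L m * mval C m)) (M1 ++ M2)
                   <= k2 ^ d * eps ^ (S (dot th m1)) * S0).
  { unfold S0; rewrite <- lsum_scal; apply lsum_le; intros m Hm.
    rewrite EM in HM; pose proof (NoDup_remove_2 _ _ _ HM) as Hnot.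
    assert (HmM : In m M) by (rewrite EM; apply in_app_iff in Hm; apply in_app_iff; simpl; tauto).
    destruct (HinM m HmM) as [Hlen Hdeg].
    destruct (Req_dec (coef L m) 0) as [E|E].
    - rewrite E, Rmult_0_l, Rabs_R0; lra.
    - rewrite Rabs_mult.
      destruct (mval_bounds k1 k2 eps C th Hk1 ltac:(lra) HC m Hlen) as [B1 [B2 B3]].
      rewrite (Rabs_pos_eq (mval C m)) by lra.
      rewrite (Rmult_comm (Rabs (coef L m))). apply Rmult_le_compat_r; [apply Rabs_pos|].
      rewrite Hdeg in *. apply Rle_trans with (k2 ^ d * eps ^ dot th m); [lra|].
      apply Rmult_le_compat_l; auto. apply pow_small; [lra|].
      assert (Hle : (dot th m1 <= dot th m)%nat) by (apply Hmin, filter_In; split; [auto|now apply Hnz]).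
      assert (Hne : dot th m1 <> dot th m).
      { intros Eq. destruct (HinM m1 Hm1) as [Hl1 Hd1].
        assert (m1 = m) by (apply Hinj; auto). subst m; contradiction. }
      lia. }
  pose proof (lsum_abs (fun m => coef L m * mval C m) (M1 ++ M2)) as Habs.
  rewrite <- Rabs_Ropp, <- HE, Rabs_mult in Habs.
  destruct (HinM m1 Hm1) as [Hl1 Hd1].
  destruct (mval_bounds k1 k2 eps C th Hk1 ltac:(lra) HC m1 Hl1) as [B1 [B2 B3]].
  rewrite (Rabs_pos_eq (mval C m1)) in Habs by lra. rewrite Hd1 in *.
  set (w := dot th m1) in *.
  assert (Hw : 0 < eps ^ w) by (apply pow_lt; lra).
  assert (Hlow : Rabs (coef L m1) * (k1 ^ d * eps ^ w) <= Rabs (coef L m1) * mval C m1)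
    by (apply Rmult_le_compat_l; lra).
  simpl pow in Hother.
  assert (Hmul : eps * (S0 * k2 ^ d + 1) <= Rabs (coef L m1) * k1 ^ d).
  { apply Rle_trans with (Rabs (coef L m1) * k1 ^ d / (S0 * k2 ^ d + 1) * (S0 * k2 ^ d + 1)).
    - apply Rmult_le_compat_r; lra.
    - right; field; lra. }
  assert (Hfin : Rabs (coef L m1) * k1 ^ d * eps ^ w <= eps * (S0 * k2 ^ d) * eps ^ w) by lra.
  apply Rmult_le_reg_r in Hfin; auto. lra.
Qed.

(** * Separation of the monomials of a given degree by digits in base [B] *)

Fixpoint digits (B : nat) (l : list nat) : nat :=
  match l with [] => 0%nat | x :: l' => (x + B * digits B l')%nat end.

Lemma digits_inj B l : forall l', length l = length l' ->
  (forall x, In x l -> (x < B)%nat) -> (forall x, In x l' -> (x < B)%nat) ->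
  digits B l = digits B l' -> l = l'.
Proof.
  induction l as [|x l IH]; intros [|y l'] Hlen H H' E; try discriminate; [reflexivity|].
  cbn [digits] in E. pose proof (H x (or_introl eq_refl)). pose proof (H' y (or_introl eq_refl)).
  assert (E1 : x = y).
  { rewrite <- (Nat.mod_small x B), <- (Nat.mod_small y B) by assumption.
    rewrite <- (Nat.Div0.mod_add x (digits B l)), <- (Nat.Div0.mod_add y (digits B l')).
    f_equal; lia. }
  subst y. f_equal. apply IH; [now injection Hlen | | |].
  - intros z Hz; apply H; right; exact Hz.
  - intros z Hz; apply H'; right; exact Hz.
  - nia.
Qed.

Lemma in_mdeg l x : In x l -> (x <= mdeg l)%nat.
Proof.
  induction l as [|y l IH]; intros []; unfold mdeg in *; cbn [fold_right]; [lia|].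
  specialize (IH H); lia.
Qed.

(** As [theta B k + 1 = B^k], adding the degree turns the weight into a number whose digits in base
    [B] are the exponents. *)
Lemma dot_theta B l : (2 <= B)%nat -> forall o,
  (dot (map (theta B) (seq o (length l))) l + mdeg l = B ^ o * digits B l)%nat.
Proof.
  intros HB; induction l as [|x l IH]; intros o; [unfold mdeg; simpl; lia|].
  cbn [length seq map dot digits]. specialize (IH (S o)).
  change (mdeg (x :: l)) with (x + mdeg l)%nat. unfold theta at 1.
  rewrite Nat.pow_succ_r' in IH. pose proof (B_pow_pos B HB o). nia.
Qed.

Lemma digits_le B l : (2 <= B)%nat -> (digits B l * B <= mdeg l * B ^ length l)%nat.
Proof.
  intros HB; induction l as [|x l IH]; [unfold mdeg; simpl; lia|].
  cbn [digits length]. change (mdeg (x :: l)) with (x + mdeg l)%nat. rewrite Nat.pow_succ_r'.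
  pose proof (B_pow_pos B HB (length l)). nia.
Qed.

(* Orders of magnitude of Cinf and the C_k; the first one is [expo_total]. *)
Definition roles_theta (B r : nat) : list nat :=
  (B ^ (r + 1) + B ^ r - 2)%nat :: map (theta B) (seq 0 (S r)).

Lemma roles_theta_length B r : length (roles_theta B r) = S (S r).
Proof. unfold roles_theta; cbn [length]; now rewrite length_map, length_seq. Qed.

(** Adding [d] to the weight gives [digits B y + x * g] with [g = B^(r+1) + B^r - 1]. Since
    [digits B y] is less than [g], the exponent [x] is the quotient by [g]; the remainder determines
    [y], all exponents being less than [B = d + 2]. *)
Lemma roles_theta_inj r d m m' :
  length m = S (S r) -> length m' = S (S r) -> mdeg m = d -> mdeg m' = d ->
  dot (roles_theta (d + 2) r) m = dot (roles_theta (d + 2) r) m' -> m = m'.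
Proof.
  intros Hl Hl' Hd Hd' E. set (B := (d + 2)%nat) in *.
  assert (HB : (2 <= B)%nat) by lia.
  assert (Hdec : forall m, length m = S (S r) -> mdeg m = d -> exists x y, m = x :: y /\ length y = S r /\
     (dot (roles_theta B r) m + d = digits B y + x * (B ^ (r + 1) + B ^ r - 1))%nat /\
     (digits B y < B ^ (r + 1) + B ^ r - 1)%nat /\ (forall z, In z y -> z < B)%nat).
  { intros [|x y] Hlen Hdeg; [discriminate|]. exists x, y. injection Hlen as Hlen.
    change (mdeg (x :: y)) with (x + mdeg y)%nat in Hdeg.
    split; [reflexivity|]. split; [exact Hlen|].
    pose proof (B_pow_pos B HB r). pose proof (B_pow_pos B HB (r + 1)).
    pose proof (dot_theta B y HB 0) as H1. rewrite Hlen in H1. simpl (B ^ 0)%nat in H1.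
    pose proof (digits_le B y HB) as H2. rewrite Hlen in H2.
    split; [|split].
    - unfold roles_theta; cbn [dot].
      replace (B ^ (r + 1) + B ^ r - 1)%nat with (B ^ (r + 1) + B ^ r - 2 + 1)%nat by lia. lia.
    - replace (S r) with (r + 1)%nat in H2 by lia.
      assert (digits B y < B ^ (r + 1))%nat; [|lia]. nia.
    - intros z Hz; pose proof (in_mdeg _ _ Hz); lia. }
  destruct (Hdec m Hl Hd) as [x [y [-> [Hy [E1 [H1 H1']]]]]].
  destruct (Hdec m' Hl' Hd') as [x' [y' [-> [Hy' [E2 [H2 H2']]]]]].
  rewrite E in E1. rewrite E1 in E2.
  set (g := (B ^ (r + 1) + B ^ r - 1)%nat) in *.
  assert (Hxx : x = x').
  { destruct (Nat.lt_trichotomy x x') as [Hc|[Hc|Hc]]; auto; exfalso; nia. }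
  subst x'. f_equal. apply (digits_inj B); auto; [congruence | lia].
Qed.

(** A nonzero homogeneous polynomial does not vanish at the points with coordinates [eps^t], [t] in
    [roles_theta], for small [eps], because one monomial dominates there. *)
Lemma ev_zero_coef (L : mpoly) r d :
  (forall p, In p L -> length (fst p) = S (S r) /\ mdeg (fst p) = d) ->
  (forall xs, length xs = S (S r) -> ev xs L = 0) -> forall m, coef L m = 0.
Proof.
  intros HL Hev m. destruct (Req_dec (coef L m) 0) as [|Hm]; auto. exfalso.
  destruct (ev_dominated L (roles_theta (d + 2) r) d 1 1 m) as [e0 [He0 H]]; try lra; auto.
  - rewrite roles_theta_length; auto.
  - rewrite roles_theta_length; apply roles_theta_inj.
  - set (eps := Rmin 1 e0).
    assert (Heps : 0 < eps <= 1) by (unfold eps, Rmin; destruct (Rle_dec 1 e0); lra).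
    apply (H eps (map (fun t => eps ^ t) (roles_theta (d + 2) r))).
    + exact Heps.
    + apply Rmin_r.
    + unfold of_order. generalize (roles_theta (d + 2) r) as l.
      induction l as [|t l IH]; cbn [map]; constructor; auto. lra.
    + apply Hev. now rewrite length_map, roles_theta_length.
Qed.

(** * Substitution of the walk into a polynomial *)

Definition rsum (xs : list R) : R := lsum (fun x => x) xs.

Fixpoint inc (i : nat) (l : mono) : mono :=
  match i, l with
  | _, [] => []
  | O, e :: l' => S e :: l'
  | S i', e :: l' => e :: inc i' l'
  end.

Lemma inc_length i : forall l, length (inc i l) = length l.
Proof. induction i as [|i IH]; intros [|e l]; simpl; auto. Qed.

Lemma inc_mdeg i : forall l, (i < length l)%nat -> mdeg (inc i l) = S (mdeg l).
Proof.
  induction i as [|i IH]; intros [|e l] H; cbn [length] in H; try lia; [reflexivity|].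
  cbn [inc]. change (e + mdeg (inc i l) = S (e + mdeg l))%nat. rewrite IH; lia.
Qed.

Lemma inc_mval i : forall xs l, length xs = length l -> (i < length l)%nat ->
  mval xs (inc i l) = nth i xs 0 * mval xs l.
Proof.
  induction i as [|i IH]; intros [|x xs] [|e l] H Hi; cbn [length] in *; try lia.
  - cbn [inc mval nth pow]; ring.
  - cbn [inc mval nth]. rewrite IH by lia; ring.
Qed.

Lemma inc_dot i : forall w l, length w = length l -> (i < length l)%nat ->
  dot w (inc i l) = (nth i w 0 + dot w l)%nat.
Proof.
  induction i as [|i IH]; intros [|x w] [|e l] H Hi; cbn [length] in *; try lia.
  - cbn [inc dot nth]; lia.
  - cbn [inc dot nth]. rewrite IH by lia; lia.
Qed.

Lemma lsum_nth {A} (d0 : A) (f : A -> R) xs : lsum (fun i => f (nth i xs d0)) (seq 0 (length xs)) = lsum f xs.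
Proof.
  induction xs as [|x xs IH]; [reflexivity|]. cbn [length seq lsum nth]. f_equal.
  rewrite <- IH, <- seq_shift, lsum_map. reflexivity.
Qed.

Lemma pe_lsum p : forall f, pe p f = lsum (fun i => nth i p 0 * f i) (seq 0 (length p)).
Proof.
  induction p as [|c p IH]; intros f; [reflexivity|]. cbn [pe length seq lsum nth]. f_equal.
  rewrite IH, <- seq_shift, lsum_map. reflexivity.
Qed.

(* An entry [(k, l, c)] stands for the term [c * (- sum X)^k * X^l]. *)
Definition entry : Type := nat * mono * R.
Definition e_exp (e : entry) := fst (fst e).
Definition e_mono (e : entry) := snd (fst e).
Definition e_coef (e : entry) := snd e.

Definition pval (xs : list R) (e : entry) : R :=
  e_coef e * (- rsum xs) ^ e_exp e * mval xs (e_mono e).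

Section Expand.
Variable n : nat.

Definition mul_neg_sum (L : mpoly) : mpoly :=
  flat_map (fun p => map (fun i => (inc i (fst p), - snd p)) (seq 0 n)) L.

Definition expand (e : entry) : mpoly := Nat.iter (e_exp e) mul_neg_sum [(e_mono e, e_coef e)].

Definition homog (d : nat) (L : mpoly) : Prop :=
  forall p, In p L -> length (fst p) = n /\ mdeg (fst p) = d.

Lemma mul_neg_sum_homog d L : homog d L -> homog (S d) (mul_neg_sum L).
Proof.
  intros H p Hp. apply in_flat_map in Hp. destruct Hp as [q [Hq Hp]].
  apply in_map_iff in Hp. destruct Hp as [i [<- Hi]]. apply in_seq in Hi.
  destruct (H q Hq) as [H1 H2]. cbn [fst]. rewrite inc_length, inc_mdeg by lia. auto.
Qed.

Lemma ev_mul_neg_sum d xs L : length xs = n -> homog d L -> ev xs (mul_neg_sum L) = - rsum xs * ev xs L.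
Proof.
  intros Hx H. unfold ev, mul_neg_sum. rewrite lsum_flat_map, <- lsum_scal.
  apply lsum_ext; intros p Hp. destruct (H p Hp) as [H1 H2]. rewrite lsum_map; cbn [fst snd].
  rewrite (lsum_ext _ (fun i => (- snd p * mval xs (fst p)) * nth i xs 0)).
  - rewrite lsum_scal, <- Hx, (lsum_nth 0 (fun x => x)). unfold rsum; ring.
  - intros i Hi; apply in_seq in Hi. rewrite inc_mval by lia. ring.
Qed.

Lemma expand_homog d e : length (e_mono e) = n -> (e_exp e + mdeg (e_mono e) = d)%nat -> homog d (expand e).
Proof.
  unfold expand. intros Hl. revert d. induction (e_exp e) as [|k IH]; intros d Hd; cbn [Nat.iter].
  - intros p [<-|[]]; cbn [fst]; auto.
  - destruct d as [|d]; [lia|]. apply mul_neg_sum_homog, IH. lia.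
Qed.

Lemma ev_expand xs e : length xs = n -> length (e_mono e) = n -> ev xs (expand e) = pval xs e.
Proof.
  intros Hx Hl. unfold expand, pval. induction (e_exp e) as [|k IH].
  - unfold ev; simpl; ring.
  - change (Nat.iter (S k) mul_neg_sum [(e_mono e, e_coef e)]) with
      (mul_neg_sum (expand (k, e_mono e, e_coef e))).
    rewrite (ev_mul_neg_sum (k + mdeg (e_mono e))); auto.
    + unfold expand, e_exp, e_mono, e_coef; cbn [fst snd]. unfold e_exp, e_mono, e_coef in IH. rewrite IH. simpl; ring.
    + apply expand_homog; auto.
Qed.

Section Act.
Variables (C : list R) (w el : list nat) (D : nat) (u : nat -> nat -> R).
Hypothesis lenC : length C = n.
Hypothesis lenw : length w = n.
Hypothesis lene : length el = n.
Hypothesis role_rec : forall s m,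
  lsum (fun i => nth i C 0 * u (s + nth i w 0)%nat (D * (nth i el 0 + m))%nat) (seq 0 n) = u (s + D)%nat (D * m)%nat.

(** Substitution of operators: variable [i] becomes [nth i C 0] times a shift of time by [nth i w 0]
    and of height by [nth i el 0] periods. *)
Definition act (j : nat) (L : mpoly) : R :=
  lsum (fun p => snd p * (mval C (fst p) * u (j + dot w (fst p))%nat (D * dot el (fst p))%nat)) L.

(** By [role_rec] the sum of the variables acts as a time shift by [D], that is, as [M^D]; the
    eliminated pure variable therefore acts as [- M^D]. *)
Lemma act_mul_neg_sum d j L : homog d L -> act j (mul_neg_sum L) = - act (j + D) L.
Proof.
  intros H. unfold act, mul_neg_sum. rewrite lsum_flat_map.
  replace (- lsum _ L) with (-1 * lsum (fun p => snd p * (mval C (fst p) *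
      u (j + D + dot w (fst p))%nat (D * dot el (fst p))%nat)) L) by ring.
  rewrite <- lsum_scal. apply lsum_ext; intros p Hp. destruct (H p Hp) as [H1 _].
  rewrite lsum_map; cbn [fst snd].
  replace (j + D + dot w (fst p))%nat with (j + dot w (fst p) + D)%nat by lia.
  rewrite <- role_rec.
  replace (-1 * _) with ((- snd p * mval C (fst p)) *
     lsum (fun i => nth i C 0 * u (j + dot w (fst p) + nth i w 0)%nat (D * (nth i el 0 + dot el (fst p)))%nat) (seq 0 n)) by ring.
  rewrite <- lsum_scal. apply lsum_ext; intros i Hi; apply in_seq in Hi.
  rewrite inc_mval, !inc_dot by lia.
  replace (j + (nth i w 0 + dot w (fst p)))%nat with (j + dot w (fst p) + nth i w 0)%nat by lia. ring.
Qed.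

Lemma act_expand e : length (e_mono e) = n -> forall j, act j (expand e) =
  e_coef e * (-1) ^ e_exp e * mval C (e_mono e)
   * u (j + D * e_exp e + dot w (e_mono e))%nat (D * dot el (e_mono e))%nat.
Proof.
  intros Hl. unfold expand. induction (e_exp e) as [|k IH]; intros j.
  - unfold act; cbn [pow].
    replace (j + D * 0 + dot w (e_mono e))%nat with (j + dot w (e_mono e))%nat by lia.
    unfold lsum; simpl Nat.iter; cbn [fst snd]; ring.
  - change (Nat.iter (S k) mul_neg_sum [(e_mono e, e_coef e)]) with
      (mul_neg_sum (expand (k, e_mono e, e_coef e))).
    rewrite (act_mul_neg_sum (k + mdeg (e_mono e))).
    + unfold expand; cbn [e_exp e_mono e_coef fst snd] in *.
      change (Nat.iter (e_exp (k, e_mono e, e_coef e)) mul_neg_sum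
                [(e_mono (k, e_mono e, e_coef e), e_coef (k, e_mono e, e_coef e))])
        with (Nat.iter k mul_neg_sum [(e_mono e, e_coef e)]).
      rewrite IH. replace (j + D + D * k + dot w (e_mono e))%nat with (j + D * S k + dot w (e_mono e))%nat by lia.
      cbn [pow]; ring.
    + apply expand_homog; auto.
Qed.

End Act.
End Expand.

(** * Roles of the variables and the values given to them by the walk *)

Definition role_weights (r : nat) : list nat := 0%nat :: seq 0 (S r).
Definition role_steps (r : nat) : list nat := 2%nat :: repeat 1%nat (S r).
(** Index 0 is the role of [Cinf]: no time and two periods. Index [k + 1] is the role of [C_k]: time
    [k] and one period. *)
Definition role_values (B r : nat) (eps : R) : list R :=
  let D := (2 * r + 1)%nat in
  bprod (wb B D eps) 0 D :: period_coefs (wa B D eps) (wb B D eps) D.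

Lemma dot_bound w W : (forall x, In x w -> (x <= W)%nat) -> forall l, (dot w l <= W * mdeg l)%nat.
Proof.
  induction w as [|x w IH]; intros H [|e l]; cbn [dot]; try lia.
  change (mdeg (e :: l)) with (e + mdeg l)%nat.
  specialize (IH (fun y Hy => H y (or_intror Hy)) l). specialize (H x (or_introl eq_refl)). nia.
Qed.

Lemma common_threshold (Q : nat -> R -> Prop) js :
  (forall j, In j js -> exists e0, 0 < e0 /\ forall eps, 0 < eps <= e0 -> Q j eps) ->
  exists e0, 0 < e0 /\ forall eps, 0 < eps <= e0 -> forall j, In j js -> Q j eps.
Proof.
  induction js as [|j js IH]; intros H.
  - exists 1; split; [lra|]. intros eps _ j [].
  - destruct (H j (or_introl eq_refl)) as [e1 [H1 Q1]].
    destruct IH as [e2 [H2 Q2]]; [intros i Hi; apply H; right; exact Hi|].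
    exists (Rmin e1 e2); split; [apply Rmin_pos; auto|]. intros eps He.
    pose proof (Rmin_l e1 e2); pose proof (Rmin_r e1 e2).
    intros i [<-|Hi]; [apply Q1; lra | apply Q2; auto; lra].
Qed.

Lemma of_order_thetas B k1 k2 eps p : forall o,
  (forall s, (s < length p)%nat -> k1 * eps ^ theta B (o + s) <= nth s p 0 <= k2 * eps ^ theta B (o + s)) ->
  of_order k1 k2 eps p (map (theta B) (seq o (length p))).
Proof.
  induction p as [|c p IH]; intros o H; [constructor|].
  cbn [length seq map]; constructor.
  - specialize (H 0%nat ltac:(cbn [length]; lia)). rewrite Nat.add_0_r in H. exact H.
  - apply IH. intros s Hs. specialize (H (S s) ltac:(cbn [length]; lia)).
    replace (S o + s)%nat with (o + S s)%nat by lia. exact H.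
Qed.

Section Roles.
Variables B r : nat.
Variable eps : R.
Hypothesis B2 : (2 <= B)%nat.
Hypothesis Heps : 0 < eps <= 1 / 2.
Let D := (2 * r + 1)%nat.

Lemma role_values_length : length (role_values B r eps) = S (S r).
Proof. unfold role_values; cbn [length]; now rewrite (period_coefs_length _ _ _ r). Qed.

Lemma role_values_order :
  of_order ((/ 2) ^ D) (2 ^ (D + 1)) eps (role_values B r eps) (roles_theta B r).
Proof.
  unfold role_values, roles_theta; fold D; constructor.
  - destruct (bprod_small B B2 D eps ltac:(unfold D; lia) D (le_n _)) as [t [-> Ht]].
    pose proof (expo_total B B2 r) as E. fold D in E. rewrite <- Ht in E.
    replace (B ^ (r + 1) + B ^ r - 2)%nat with t by lia.
    assert (0 < eps ^ t) by (apply pow_lt; lra).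
    assert ((/ 2) ^ D <= 1) by (rewrite <- (pow1 D); apply pow_incr; lra).
    assert (1 <= 2 ^ (D + 1)) by (rewrite <- (pow1 (D + 1)); apply pow_incr; lra).
    nra.
  - rewrite <- (period_coefs_length (wa B D eps) (wb B D eps) D r eq_refl).
    apply of_order_thetas. intros s Hs.
    rewrite (period_coefs_length _ _ D r eq_refl) in Hs.
    apply (period_coefs_bounds B B2 D eps ltac:(unfold D; lia) Heps r s eq_refl). lia.
Qed.

Lemma role_values_rec (u : nat -> nat -> R) :
  (forall s i, u (S s) i = wa B D eps i * u s (S i) + wb B D eps i * u s (S (S i))) ->
  forall s m,
  lsum (fun i => nth i (role_values B r eps) 0 *
     u (s + nth i (role_weights r) 0)%nat (D * (nth i (role_steps r) 0 + m))%nat) (seq 0 (S (S r)))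
  = u (s + D)%nat (D * m)%nat.
Proof.
  intros Hu s m. rewrite (Nat.mul_comm D m).
  rewrite (period_recurrence _ _ D (wa_period B D eps) (wb_period B D eps) u Hu r) by reflexivity.
  rewrite pe_lsum, (period_coefs_length _ _ D r eq_refl).
  change (seq 0 (S (S r))) with (0%nat :: seq 1 (S r)). cbn [lsum].
  rewrite <- (seq_shift (S r) 0), lsum_map, Rplus_comm. f_equal.
  - apply lsum_ext; intros i Hi; apply in_seq in Hi.
    unfold role_values, role_weights, role_steps; fold D; cbn [nth].
    change (nth (S i) (2%nat :: repeat 1%nat (S r)) 0%nat) with (nth i (repeat 1%nat (S r)) 0%nat).
    change (nth (S i) (0%nat :: seq 0 (S r)) 0%nat) with (nth i (seq 0 (S r)) 0%nat).
    rewrite seq_nth, nth_repeat_lt by lia. f_equal. f_equal; lia.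
  - unfold role_values, role_weights, role_steps; fold D; cbn [nth]. f_equal. f_equal; lia.
Qed.

(** The recurrence applied to the constant function 1. *)
Lemma role_values_sum : rsum (role_values B r eps) = 1.
Proof.
  pose proof (role_values_rec (fun _ _ => 1)) as H. specialize (H ltac:(intros s i; cbv beta; pose proof (wab B D eps i); lra) 0%nat 0%nat).
  rewrite <- H, <- role_values_length. unfold rsum.
  rewrite (lsum_nth 0 (fun x => x * 1)). apply lsum_ext; intros; ring.
Qed.

End Roles.

(** The bound for one assignment of roles. The entry with exponent [d] has the greatest time
    [(2r + 1) * d], so the sweep bounds the distance from there down to the time of any entry. *)
Lemma core_bound (r d : nat) (es : list entry) :
  (forall e, In e es -> length (e_mono e) = S (S r) /\ (e_exp e + mdeg (e_mono e) = d)%nat /\ e_coef e <> 0) ->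
  NoDup (map fst es) ->
  (forall xs, length xs = S (S r) -> lsum (pval xs) es = 0) ->
  (forall f : entry -> bool, (exists e, In e es /\ f e = true) -> (exists e, In e es /\ f e = false) ->
     exists xs, length xs = S (S r) /\ lsum (pval xs) (filter f es) <> 0) ->
  (exists e, In e es /\ e_exp e = d) ->
  forall e, In e es ->
  ((2 * r + 1) * d + 5 <= 2 * length es + (2 * r + 1) * e_exp e + dot (role_weights r) (e_mono e))%nat.
Proof.
  intros Hes Hnd Hzero Hind [ed [Hed Hedd]] e0 He0.
  set (D := (2 * r + 1)%nat). set (B := (d + 2)%nat). set (n := S (S r)).
  set (time := fun e => (D * e_exp e + dot (role_weights r) (e_mono e))%nat).
  assert (Hwle : forall l, (dot (role_weights r) l <= r * mdeg l)%nat).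
  { apply dot_bound. intros x [<-|Hx]; [lia|]. apply in_seq in Hx; lia. }
  assert (Hmono0 : forall l, mdeg l = 0%nat -> l = repeat 0%nat (length l)).
  { induction l as [|x l IH]; intros H; [reflexivity|].
    change (x + mdeg l = 0)%nat in H. cbn [length repeat]. rewrite <- IH by lia. f_equal; lia. }
  destruct (exists_min time es) as [elo [Hlo Hmin]]; [intros ->; destruct He0|].
  assert (Hted : time ed = (D * d)%nat).
  { destruct (Hes ed Hed) as [_ [H _]]. unfold time. pose proof (Hwle (e_mono ed)). nia. }
  assert (Hle : forall e, In e es -> (time e <= D * d)%nat).
  { intros e He. destruct (Hes e He) as [_ [H _]]. unfold time. pose proof (Hwle (e_mono e)).
    unfold D in *. nia. }
  (* Otherwise every entry is the pure power; the keys being distinct, there is only one entry, and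
     it does not vanish where all variables equal 1. *)
  assert (Hlt : (time elo < D * d)%nat).
  { destruct (Nat.lt_ge_cases (time elo) (D * d)) as [|Hge]; auto. exfalso.
    assert (Hkey : forall e, In e es -> fst e = (d, repeat 0%nat n)).
    { intros e He. destruct (Hes e He) as [H1 [H2 _]]. specialize (Hmin e He).
      assert (H0 : mdeg (e_mono e) = 0%nat).
      { pose proof (Hwle (e_mono e)). unfold time, D in *. nia. }
      rewrite (surjective_pairing (fst e)). f_equal.
      - change (e_exp e = d). lia.
      - change (e_mono e = repeat 0%nat n). rewrite (Hmono0 _ H0). now rewrite H1. }
    assert (Hone : es = [ed]).
    { destruct es as [|e1 [|e2 es]]; [destruct Hed| |].
      - destruct Hed as [->|[]]; reflexivity.
      - exfalso. cbn [map] in Hnd. inversion Hnd as [|x y Hn _]; subst. apply Hn; left.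
        rewrite !Hkey by (simpl; auto); reflexivity. }
    specialize (Hzero (repeat 1 n) (repeat_length _ _)). rewrite Hone in Hzero. cbn [lsum] in Hzero.
    destruct (Hes ed Hed) as [_ [_ Hc]]. unfold pval in Hzero.
    assert (Em : e_mono ed = repeat 0%nat n)
      by (pose proof (Hkey ed Hed) as K; unfold e_mono; rewrite K; reflexivity).
    assert (Ev : mval (repeat 1 n) (e_mono ed) = 1).
    { rewrite Em. generalize n as k. induction k as [|k IHk]; cbn [repeat mval]; [reflexivity|].
      rewrite IHk; simpl; ring. }
    rewrite Ev in Hzero.
    assert (Hr : rsum (repeat 1 n) <> 0).
    { assert (forall k, rsum (repeat 1 k) = INR k).
      { induction k as [|k IHk]; [reflexivity|]. rewrite S_INR; unfold rsum in *; cbn [repeat lsum]; lra. }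
      rewrite H. apply not_0_INR; unfold n; lia. }
    assert (Hp : (- rsum (repeat 1 n)) ^ e_exp ed <> 0) by (apply pow_nonzero; lra).
    apply (Rmult_integral_contrapositive_currified _ _ Hc Hp). lra. }
  assert (HP : forall f, homog n d (flat_map (expand n) (filter f es)) /\
     forall xs, length xs = n -> ev xs (flat_map (expand n) (filter f es)) = lsum (pval xs) (filter f es)).
  { intros f; split.
    - intros p Hp. apply in_flat_map in Hp. destruct Hp as [e [He Hp]]. apply filter_In in He.
      destruct (Hes e (proj1 He)) as [H1 [H2 _]]. apply (expand_homog n d e H1 H2 p Hp).
    - intros xs Hx. unfold ev. rewrite lsum_flat_map. apply lsum_ext; intros e He. apply filter_In in He.
      destruct (Hes e (proj1 He)) as [H1 _]. apply (ev_expand n xs e Hx H1). }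
  set (C := role_values B r).
  set (tail := fun j e => (j <=? time e)%nat).
  (* The entries of time at least [j] include [ed] but not [elo], so their sum is not identically
     zero and does not vanish at the role values for small [eps]. Only finitely many [j] occur,
     whence a common threshold. *)
  assert (HQ : exists t, 0 < t /\ forall eps, 0 < eps <= t -> forall j, In j (seq (S (time elo)) (D * d - time elo)) ->
      eps <= 1 / 2 -> lsum (pval (C eps)) (filter (tail j) es) <> 0).
  { apply (common_threshold (fun j eps => eps <= 1 / 2 -> lsum (pval (C eps)) (filter (tail j) es) <> 0)).
    intros j Hj; apply in_seq in Hj.
    destruct (Hind (tail j)) as [xs [Hxs Hne]].
    - exists ed; split; auto. unfold tail; apply Nat.leb_le; lia.
    - exists elo; split; auto. unfold tail; apply Nat.leb_gt; lia.
    - destruct (HP (tail j)) as [HL HE]. set (L := flat_map (expand n) (filter (tail j) es)) in *.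
      assert (Hm : exists m, coef L m <> 0).
      { apply not_all_ex_not; intros H. apply Hne. rewrite <- HE by auto. unfold ev.
        rewrite (lsum_collect (mval xs) L (nodup mono_eq_dec (map fst L))).
        - apply lsum_zero; intros m _; rewrite H; ring.
        - apply NoDup_nodup.
        - intros m Hm; now apply nodup_In. }
      destruct Hm as [m Hm].
      destruct (ev_dominated L (roles_theta B r) d ((/ 2) ^ D) (2 ^ (D + 1)) m) as [t [Ht Hdom]]; auto.
      + apply pow_lt; lra.
      + apply pow_le; lra.
      + rewrite roles_theta_length; exact HL.
      + rewrite roles_theta_length; unfold B; apply roles_theta_inj.
      + exists t; split; auto. intros eps He Hhalf. rewrite <- HE.
        * apply (Hdom eps); try lra. apply role_values_order; [unfold B; lia | lra].
        * apply role_values_length. }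
  destruct HQ as [t [Ht HQ]].
  set (eps := Rmin t (1 / 2)).
  assert (Heps : 0 < eps) by (apply Rmin_pos; lra).
  assert (Heps1 : eps <= t) by apply Rmin_l. assert (Heps2 : eps <= 1 / 2) by apply Rmin_r.
  set (a := wa B D eps). set (b := wb B D eps).
  assert (HB2 : (2 <= B)%nat) by (unfold B; lia).
  set (T := map (fun e => (time e, (D * dot (role_steps r) (e_mono e))%nat,
                  e_coef e * (-1) ^ e_exp e * mval (C eps) (e_mono e)) : term) es).
  (* The role values add up to 1, so the pure variable takes the value -1 and the mass of a term is
     the value of its entry. *)
  assert (HT : forall j, lsum (fun t => if (j <=? t_time t)%nat then t_coef t else 0) T
                = lsum (pval (C eps)) (filter (tail j) es)).
  { intros j. unfold T; rewrite lsum_map. clear -Heps Heps2 HB2. induction es as [|e es IH]; [reflexivity|].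
    cbn [lsum filter]. rewrite IH. unfold t_time, t_coef, tail; cbn [fst snd].
    destruct (j <=? time e)%nat; cbn [lsum]; [|ring]. unfold pval.
    unfold C; rewrite role_values_sum by (auto; lra). f_equal. }
  assert (HS : (D * d - time elo + 5 <= 2 * length T)%nat).
  { apply (sweep a b).
    - intros h; apply wa_pos; [exact HB2 | lra].
    - intros h; apply wb_pos; lra.
    - intros h; apply wab.
    - exact Hlt.
    - intros u Hu. unfold T in Hu; apply in_map_iff in Hu. destruct Hu as [e [<- He]].
      unfold t_time; cbn [fst]. split; [apply Hmin | apply Hle]; exact He.
    (* The total combination is the substitution applied to the expanded polynomial, all of whose
       coefficients are zero. *)
    - intros x.
      set (u := fun s i => walk a b s i x).
      assert (Hrec := role_values_rec B r eps HB2 u (fun s i => eq_refl)).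
      assert (Hact : act (C eps) (role_weights r) (role_steps r) D u 0 (flat_map (expand n) es) = tailsum a b T 0 x).
      { unfold act. rewrite lsum_flat_map. unfold tailsum, T. rewrite lsum_map.
        apply lsum_ext; intros e He. destruct (Hes e He) as [H1 _].
        change (act (C eps) (role_weights r) (role_steps r) D u 0 (expand n e) =
          e_coef e * (-1) ^ e_exp e * mval (C eps) (e_mono e) *
            walk a b (time e - 0) (D * dot (role_steps r) (e_mono e)) x).
        rewrite (act_expand n); auto.
        - unfold u, time. do 2 f_equal. lia.
        - apply role_values_length.
        - unfold role_weights; cbn [length]; now rewrite length_seq.
        - unfold role_steps; cbn [length]; now rewrite repeat_length. }
      rewrite <- Hact. unfold act. set (L := flat_map (expand n) es).
      destruct (HP (fun _ => true)) as [HL HE]. rewrite filter_true in HL, HE. fold L in HL, HE.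
      rewrite (lsum_collect (fun m => mval (C eps) m * u (0 + dot (role_weights r) m)%nat (D * dot (role_steps r) m)%nat)
                 L (nodup mono_eq_dec (map fst L))).
      + apply lsum_zero; intros m _. rewrite (ev_zero_coef L r d); auto; [ring|].
        intros xs Hxs; rewrite HE by auto; auto.
      + apply NoDup_nodup.
      + intros m Hm; now apply nodup_In.
    - intros j Hj. rewrite HT. apply HQ; auto. apply in_seq; lia. }
  unfold T in HS. rewrite length_map in HS. specialize (Hmin e0 He0). unfold time in *. lia.
Qed.

(** * Coordinates relative to the pure variable *)

Fixpoint lprod {A : Type} (f : A -> R) (l : list A) : R :=
  match l with [] => 1 | x :: l' => f x * lprod f l' end.

Lemma lprod_perm {A} (f : A -> R) l l' : Permutation l l' -> lprod f l = lprod f l'.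
Proof. induction 1; simpl; try congruence; ring. Qed.

Lemma lprod_map {A B} (f : B -> R) (g : A -> B) l : lprod f (map g l) = lprod (fun x => f (g x)) l.
Proof. induction l as [|x l IH]; simpl; [reflexivity | now rewrite IH]. Qed.

Lemma mdeg_perm l l' : Permutation l l' -> mdeg l = mdeg l'.
Proof. unfold mdeg; induction 1; simpl; lia. Qed.

Lemma map_nth_seq {A} (x0 : A) l : map (fun i => nth i l x0) (seq 0 (length l)) = l.
Proof.
  induction l as [|x l IH]; [reflexivity|]. cbn [length seq map nth]. f_equal.
  rewrite <- seq_shift, map_map. exact IH.
Qed.

Lemma mon_eval_lprod x m : forall o,
  mon_eval_from x m o = lprod (fun i => x (o + i)%nat ^ nth i m 0%nat) (seq 0 (length m)).
Proof.
  induction m as [|e m IH]; intros o; [reflexivity|]. cbn [mon_eval_from length seq lprod nth].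
  rewrite Nat.add_0_r, IH, <- seq_shift, lprod_map. f_equal.
  generalize (seq 0 (length m)) as s; induction s as [|i s IHs]; [reflexivity|]; cbn [lprod nth].
  rewrite IHs. do 3 f_equal; lia.
Qed.

Lemma mval_lprod (g : nat -> R) (h : nat -> nat) s :
  mval (map g s) (map h s) = lprod (fun i => g i ^ h i) s.
Proof. induction s as [|i s IH]; simpl; [reflexivity | now rewrite IH]. Qed.

Lemma sum_f_R0_lsum x n : sum_f_R0 x n = lsum x (seq 0 (S n)).
Proof.
  induction n as [|n IH]; [simpl; ring|]. rewrite seq_S, lsum_app, <- IH; simpl; ring.
Qed.

Definition bump (j v : nat) : nat := if (v <? j)%nat then v else S v.

Lemma rotation_perm n c : Permutation (map (fun i => (i + c) mod n)%nat (seq 0 n)) (seq 0 n).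
Proof.
  apply NoDup_Permutation_bis.
  - apply NoDup_map_NoDup_ForallPairs; [|apply seq_NoDup].
    intros i j Hi Hj E; apply in_seq in Hi, Hj.
    pose proof (Nat.div_mod_eq (i + c) n) as E1. pose proof (Nat.div_mod_eq (j + c) n) as E2.
    rewrite E in E1.
    destruct (Nat.lt_trichotomy ((i + c) / n) ((j + c) / n)) as [H|[H|H]]; nia.
  - rewrite length_map; apply le_n.
  - intros v Hv; apply in_map_iff in Hv; destruct Hv as [i [<- Hi]]; apply in_seq in Hi.
    apply in_seq. split; [lia|]. apply Nat.mod_upper_bound; lia.
Qed.

Lemma bump_perm n j : (j <= n)%nat -> Permutation (j :: map (bump j) (seq 0 n)) (seq 0 (S n)).
Proof.
  intros Hj. apply NoDup_Permutation_bis.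
  - constructor.
    + intros H; apply in_map_iff in H; destruct H as [i [E _]]. unfold bump in E.
      destruct (Nat.ltb_spec i j); lia.
    + apply NoDup_map_NoDup_ForallPairs; [|apply seq_NoDup].
      intros i i' _ _; unfold bump. destruct (Nat.ltb_spec i j), (Nat.ltb_spec i' j); lia.
  - cbn [length]; rewrite length_map, !length_seq; lia.
  - intros v [<-|Hv]; apply in_seq; [lia|]. apply in_map_iff in Hv; destruct Hv as [i [<- Hi]].
    apply in_seq in Hi; unfold bump; destruct (Nat.ltb_spec i j); lia.
Qed.

Section Coordinates.
Variables n j0 c : nat.
Hypothesis Hj0 : (j0 <= n)%nat.

(** The variable that plays role [i]: the variables other than [j0], rotated by [c]. *)
Definition coord (i : nat) : nat := bump j0 ((i + c) mod n).

Lemma coord_perm : Permutation (j0 :: map coord (seq 0 n)) (seq 0 (S n)).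
Proof.
  rewrite <- (bump_perm n j0 Hj0). apply perm_skip. unfold coord.
  rewrite <- (map_map (fun i => (i + c) mod n)%nat (bump j0)).
  apply Permutation_map, rotation_perm.
Qed.

Definition other_exps (m : mono) : mono := map (fun i => nth (coord i) m 0%nat) (seq 0 n).

Lemma other_exps_mdeg m : length m = S n -> (nth j0 m 0 + mdeg (other_exps m) = mdeg m)%nat.
Proof.
  intros Hm. change (mdeg (nth j0 m 0%nat :: other_exps m) = mdeg m).
  unfold other_exps. rewrite <- (map_map coord (fun v => nth v m 0%nat)).
  change (nth j0 m 0%nat :: map (fun v => nth v m 0%nat) (map coord (seq 0 n)))
    with (map (fun v => nth v m 0%nat) (j0 :: map coord (seq 0 n))).
  rewrite (mdeg_perm _ _ (Permutation_map _ coord_perm)), <- Hm, map_nth_seq. reflexivity.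
Qed.

Lemma other_exps_inj m m' : length m = S n -> length m' = S n ->
  nth j0 m 0%nat = nth j0 m' 0%nat -> other_exps m = other_exps m' -> m = m'.
Proof.
  intros Hm Hm' H0 H. rewrite <- (map_nth_seq 0%nat m), <- (map_nth_seq 0%nat m'), Hm, Hm'.
  apply map_ext_in. intros v Hv. apply (Permutation_in _ (Permutation_sym coord_perm)) in Hv.
  destruct Hv as [<-|Hv]; [exact H0|]. apply in_map_iff in Hv. destruct Hv as [i [<- Hi]].
  unfold other_exps in H. exact (proj1 map_ext_in_iff H i Hi).
Qed.

Definition to_entry (c0 : mono -> R) (m : mono) : entry := ((nth j0 m 0%nat, other_exps m), c0 m).

Definition others (x : nat -> R) : list R := map (fun i => x (coord i)) (seq 0 n).

Lemma others_sum x : x j0 + rsum (others x) = Ssum n x.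
Proof.
  unfold Ssum. rewrite sum_f_R0_lsum, <- (lsum_perm _ _ _ coord_perm). cbn [lsum].
  unfold rsum, others. now rewrite !lsum_map.
Qed.

Lemma pval_to_entry c0 x m : length m = S n -> Ssum n x = 0 ->
  pval (others x) (to_entry c0 m) = c0 m * mon_eval_from x m 0.
Proof.
  intros Hm Hx. rewrite <- others_sum in Hx.
  rewrite mon_eval_lprod, Hm, <- (lprod_perm _ _ _ coord_perm). cbn [lprod]. rewrite lprod_map.
  unfold pval, to_entry, e_coef, e_exp, e_mono; cbn [fst snd].
  replace (- rsum (others x)) with (x j0) by lra.
  unfold others, other_exps. rewrite mval_lprod. cbn [Nat.add]. ring.
Qed.

(** On the hyperplane the variable [j0] is minus the sum of the others, which are free; vanishing
    there is vanishing at all values of the others. *)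
Lemma others_surj xs : length xs = n -> exists x, Ssum n x = 0 /\ others x = xs.
Proof.
  intros Hxs.
  pose proof (Permutation_NoDup (Permutation_sym coord_perm) (seq_NoDup (S n) 0)) as Hnd.
  inversion Hnd as [|y l Hnot Hnd']; subst y l.
  set (x := fun v => if (v =? j0)%nat then - rsum xs
             else lsum (fun i => if (coord i =? v)%nat then nth i xs 0 else 0) (seq 0 n)).
  assert (Hx : others x = xs).
  { rewrite <- (map_nth_seq 0 xs) at 1. rewrite Hxs. apply map_ext_in; intros i Hi. unfold x.
    destruct (Nat.eqb_spec (coord i) j0) as [E|_].
    - destruct Hnot. rewrite <- E. apply in_map, Hi.
    - rewrite <- (lsum_single Nat.eq_dec i (fun i => nth i xs 0) (seq 0 n) (seq_NoDup _ _) Hi).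
      apply lsum_ext; intros k Hk.
      destruct (Nat.eq_dec i k) as [->|Hne]; [now rewrite Nat.eqb_refl|].
      destruct (Nat.eqb_spec (coord k) (coord i)) as [E|]; [|reflexivity].
      exfalso; apply Hne. clear -Hnd' E Hi Hk. revert Hnd' E Hi Hk.
      generalize (seq 0 n) as l. induction l as [|y l IH]; intros Hnd' E Hi Hk; [destruct Hi|].
      cbn [map] in Hnd'; inversion Hnd' as [|z l' Hz Hnd2]; subst.
      destruct Hi as [<-|Hi], Hk as [<-|Hk]; auto; exfalso; apply Hz.
      + rewrite <- E; now apply in_map.
      + rewrite E; now apply in_map. }
  exists x; split; [|exact Hx]. rewrite <- others_sum, Hx. unfold x. rewrite Nat.eqb_refl. ring.
Qed.

End Coordinates.

(** * Polynomials as lists of their monomials *)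

Definition with_coefs (g : mono -> R) (U : list mono) : mpoly := map (fun m => (m, g m)) U.

Lemma coef_map_inj (h : mono -> mono) (g : mono -> R) U m0 : NoDup U -> In m0 U ->
  (forall m, In m U -> h m = h m0 -> m = m0) -> coef (map (fun m => (h m, g m)) U) (h m0) = g m0.
Proof.
  intros Hnd Hin Hinj.
  transitivity (lsum (fun m => if mono_eq_dec m0 m then g m else 0) U).
  - clear Hnd Hin. induction U as [|m U IH]; [reflexivity|]. cbn [map]. rewrite coef_cons; cbn [fst snd lsum].
    rewrite IH by (intros m' Hm'; apply Hinj; right; exact Hm').
    destruct (mono_eq_dec (h m) (h m0)) as [E|E], (mono_eq_dec m0 m) as [E'|E']; auto.
    + destruct E'. symmetry. apply Hinj; auto; left; reflexivity.
    + destruct E; congruence.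
  - now apply lsum_single.
Qed.

Lemma with_coefs_in g U m : NoDup U -> In m U -> coef (with_coefs g U) m = g m.
Proof. intros Hnd Hm. apply (coef_map_inj (fun m => m) g U m Hnd Hm); auto. Qed.

Lemma with_coefs_notin g U m : ~ In m U -> coef (with_coefs g U) m = 0.
Proof.
  intros Hm; apply coef_notin. unfold with_coefs. rewrite map_map; cbn [fst]. now rewrite map_id.
Qed.

Lemma lsum_coef_ext (phi : mono -> R) P Q : (forall m, coef P m = coef Q m) ->
  lsum (fun p => snd p * phi (fst p)) P = lsum (fun p => snd p * phi (fst p)) Q.
Proof.
  intros H. set (M := nodup mono_eq_dec (map fst P ++ map fst Q)).
  assert (HM : NoDup M) by apply NoDup_nodup.
  rewrite (lsum_collect phi P M HM), (lsum_collect phi Q M HM).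
  - apply lsum_ext; intros m _; now rewrite H.
  - intros m Hm; apply nodup_In, in_app_iff; now right.
  - intros m Hm; apply nodup_In, in_app_iff; now left.
Qed.

Lemma eval_lsum P x : eval P x = lsum (fun p => snd p * mon_eval_from x (fst p) 0) P.
Proof. unfold eval; induction P as [|p P IH]; cbn [fold_right lsum]; [reflexivity|now rewrite IH]. Qed.

Lemma lsum_filter_split {A} (f : A -> bool) (g : A -> R) l :
  lsum g (filter f l) + lsum g (filter (fun x => negb (f x)) l) = lsum g l.
Proof. induction l as [|x l IH]; cbn [filter lsum]; [ring|]. destruct (f x); cbn [negb lsum]; lra. Qed.

Lemma nth_pure n j d : (j <= n)%nat -> nth j (pure n j d) 0%nat = d.
Proof.
  intros Hj; unfold pure. set (f := fun i => if (i =? j)%nat then d else 0%nat).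
  rewrite (nth_indep _ 0%nat (f 0%nat)) by (rewrite length_map, length_seq; lia).
  rewrite map_nth, seq_nth by lia. unfold f; cbn [Nat.add]. now rewrite Nat.eqb_refl.
Qed.

Lemma mdeg_pure n j d : (j <= n)%nat -> mdeg (pure n j d) = d.
Proof.
  intros Hj.
  assert (H : forall l o, mdeg (map (fun i => if (i =? j)%nat then d else 0%nat) (seq o l))
            = if (andb (o <=? j) (j <? o + l))%nat then d else 0%nat).
  { induction l as [|l IH]; intros o; cbn [seq map].
    - destruct (Nat.leb_spec o j), (Nat.ltb_spec j (o + 0)); simpl; try lia; reflexivity.
    - unfold mdeg in *; cbn [fold_right]; rewrite IH.
      destruct (Nat.eqb_spec o j), (Nat.leb_spec (S o) j), (Nat.leb_spec o j),
        (Nat.ltb_spec j (S o + l)), (Nat.ltb_spec j (o + S l)); simpl; lia. }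
  unfold pure; rewrite H. destruct (Nat.leb_spec 0 j), (Nat.ltb_spec j (0 + S n)); simpl; lia.
Qed.

Lemma mdeg_vadd a : forall m, length a = length m -> mdeg (vadd a m) = (mdeg a + mdeg m)%nat.
Proof.
  unfold vadd, mdeg; induction a as [|x a IH]; intros [|y m] H; try discriminate; [reflexivity|].
  cbn [combine map fold_right fst snd]. rewrite IH by (now injection H). lia.
Qed.

Definition lower (n j k : nat) (m : mono) : mono :=
  map (fun v => if (v =? j)%nat then (nth v m 0 - k)%nat else nth v m 0%nat) (seq 0 (S n)).

Lemma vadd_lower n j k m : length m = S n -> (k <= nth j m 0)%nat -> vadd (pure n j k) (lower n j k m) = m.
Proof.
  intros Hm Hk. rewrite <- (map_nth_seq 0%nat m) at 2. rewrite Hm. unfold vadd, pure, lower.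
  generalize (seq 0 (S n)) as l; induction l as [|v l IH]; [reflexivity|].
  cbn [map combine fst snd]. rewrite IH; f_equal. destruct (Nat.eqb_spec v j); subst; lia.
Qed.

Definition support (P : mpoly) : list mono :=
  nodup mono_eq_dec (filter (fun m => if Req_EM_T (coef P m) 0 then false else true) (map fst P)).

Lemma support_spec P m : In m (support P) <-> coef P m <> 0.
Proof.
  unfold support. rewrite nodup_In, filter_In. split.
  - intros [_ H]. destruct (Req_EM_T (coef P m) 0); congruence.
  - intros H; split; [|destruct (Req_EM_T (coef P m) 0); congruence].
    destruct (in_dec mono_eq_dec m (map fst P)) as [|Hn]; auto. destruct (H (coef_notin _ _ Hn)).
Qed.

Lemma coef_restrict P (g : mono -> bool) m :
  coef (with_coefs (coef P) (filter g (support P))) m = if g m then coef P m else 0.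
Proof.
  assert (Hnd : NoDup (filter g (support P))) by apply NoDup_filter, NoDup_nodup.
  destruct (in_dec mono_eq_dec m (filter g (support P))) as [H|H].
  - rewrite with_coefs_in by auto. apply filter_In in H. now rewrite (proj2 H).
  - rewrite with_coefs_notin by auto. destruct (g m) eqn:E; auto.
    destruct (Req_dec (coef P m) 0) as [|Hc]; auto.
    destruct H. apply filter_In; split; auto. now apply support_spec.
Qed.

Lemma dot_lsum w (h : nat -> nat) s : length w = length s ->
  INR (dot w (map h s)) = lsum (fun p => INR (fst p) * INR (h (snd p))) (combine w s).
Proof.
  revert w; induction s as [|i s IH]; intros [|x w] H; try discriminate; [reflexivity|].
  cbn [map dot combine lsum fst snd]. rewrite plus_INR, mult_INR, IH by (now injection H). reflexivity.
Qed.

Lemma mdeg_lsum (h : nat -> nat) s : INR (mdeg (map h s)) = lsum (fun i => INR (h i)) s.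
Proof.
  unfold mdeg; induction s as [|i s IH]; [reflexivity|].
  cbn [map fold_right lsum]. now rewrite plus_INR, IH.
Qed.

(** * From indecomposability to the averaged bound *)

Section Transfer.
Variables (r j0 d : nat) (P : mpoly).
Let n := S (S r).
Hypothesis Hj0 : (j0 <= n)%nat.
Hypothesis HI : In_I n P.
Hypothesis Hindec : indecomposable n P.
Hypothesis Hdeg : forall m, coef P m <> 0 -> mdeg m = d.
Hypothesis Hpure : coef P (pure n j0 d) <> 0.

Lemma support_length m : In m (support P) -> length m = S n.
Proof.
  intros H. destruct HI as [Hwf _]. unfold wf in Hwf; rewrite Forall_forall in Hwf.
  apply nodup_In, filter_In in H. destruct H as [H _]. apply in_map_iff in H.
  destruct H as [p [<- Hp]]. auto.
Qed.

Let ent (c : nat) := to_entry n j0 c (coef P).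

Lemma eval_restrict c g x : Ssum n x = 0 ->
  eval (with_coefs (coef P) (filter g (support P))) x
  = lsum (pval (others n j0 c x)) (map (ent c) (filter g (support P))).
Proof.
  intros Hx. rewrite eval_lsum. unfold with_coefs; rewrite !lsum_map. apply lsum_ext; intros m Hm.
  cbn [fst snd]. symmetry; apply pval_to_entry; auto. apply support_length.
  apply filter_In in Hm; tauto.
Qed.

Lemma restrict_in_I c g :
  (forall xs, length xs = n -> lsum (pval xs) (map (ent c) (filter g (support P))) = 0) ->
  In_I n (with_coefs (coef P) (filter g (support P))).
Proof.
  intros H. split; [|split].
  - unfold wf; rewrite Forall_forall. intros p Hp. apply in_map_iff in Hp. destruct Hp as [m [<- Hm]].
    apply support_length. apply filter_In in Hm; tauto.
  - exists d. intros m Hm. rewrite coef_restrict in Hm. destruct (g m); [auto|congruence].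
  - intros x Hx. rewrite (eval_restrict c) by auto. apply H. unfold others; now rewrite length_map, length_seq.
Qed.

Lemma support_bound c m : In m (support P) ->
  ((2 * r + 1) * d + 5 <= 2 * Nmon P + (2 * r + 1) * nth j0 m 0
      + dot (role_weights r) (other_exps n j0 c m))%nat.
Proof.
  intros Hm. change (Nmon P) with (length (support P)). rewrite <- (length_map (ent c)).
  apply (core_bound r d (map (ent c) (support P)) ) with (e := ent c m); [| | | | |now apply in_map].
  - intros e He. apply in_map_iff in He. destruct He as [m' [<- Hm']].
    pose proof (support_length _ Hm') as Hl. apply support_spec in Hm'. split; [|split].
    + unfold ent, to_entry, e_mono, other_exps; cbn [fst snd]. now rewrite length_map, length_seq.
    + unfold ent, to_entry, e_exp, e_mono; cbn [fst snd]. rewrite other_exps_mdeg; auto.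
    + exact Hm'.
  - rewrite map_map. apply NoDup_map_NoDup_ForallPairs; [|apply NoDup_nodup].
    intros m1 m2 H1 H2 E. unfold ent, to_entry in E; cbn [fst] in E. apply pair_equal_spec in E; destruct E as [E1 E2].
    apply (other_exps_inj n j0 c Hj0); auto using support_length.
  - intros xs Hxs. destruct (others_surj n j0 c Hj0 xs Hxs) as [x [Hx <-]].
    rewrite <- (filter_true (support P)).
    rewrite <- (eval_restrict c) by auto. rewrite eval_lsum.
    rewrite (lsum_coef_ext (fun m => mon_eval_from x m 0) _ P) by (intros m'; apply coef_restrict).
    rewrite <- eval_lsum. destruct HI as [_ [_ H]]; auto.
  (* If the selected part vanished identically, so would its complement, because [P] does; the two
     parts would then decompose [P]. *)
  - intros f [e1 [He1 Hf1]] [e2 [He2 Hf2]]. apply NNPP; intros Hno.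
    apply in_map_iff in He1; destruct He1 as [m1 [<- Hm1]].
    apply in_map_iff in He2; destruct He2 as [m2 [<- Hm2]].
    set (g := fun m => f (ent c m)).
    assert (Hg : forall xs, length xs = n -> lsum (pval xs) (map (ent c) (filter g (support P))) = 0).
    { intros xs Hxs. apply NNPP; intros H. apply Hno. exists xs; split; auto. now rewrite filter_map_swap. }
    assert (Hg' : forall xs, length xs = n ->
       lsum (pval xs) (map (ent c) (filter (fun m => negb (g m)) (support P))) = 0).
    { intros xs Hxs. specialize (Hg xs Hxs).
      destruct (others_surj n j0 c Hj0 xs Hxs) as [x [Hx <-]].
      rewrite lsum_map in *.
      pose proof (lsum_filter_split g (fun m => pval (others n j0 c x) (ent c m)) (support P)) as Hs.
      assert (Hz : lsum (fun m => pval (others n j0 c x) (ent c m)) (support P) = 0).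
      { rewrite <- lsum_map. rewrite <- (filter_true (support P)).
        rewrite <- (eval_restrict c) by auto. rewrite eval_lsum.
        rewrite (lsum_coef_ext (fun m => mon_eval_from x m 0) _ P) by (intros m'; apply coef_restrict).
        rewrite <- eval_lsum. destruct HI as [_ [_ H]]; auto. }
      lra. }
    apply Hindec. exists (with_coefs (coef P) (filter g (support P))),
      (with_coefs (coef P) (filter (fun m => negb (g m)) (support P))).
    split; [now apply (restrict_in_I c)|]. split; [now apply (restrict_in_I c)|].
    split; [exists m1; rewrite coef_restrict; unfold g; rewrite Hf1; now apply support_spec|].
    split; [exists m2; rewrite coef_restrict; unfold g; rewrite Hf2; now apply support_spec|].
    split; intros m'; rewrite !coef_restrict; destruct (g m'); cbn [negb]; auto; ring.
  - exists (ent c (pure n j0 d)). split; [now apply in_map, support_spec|].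
    unfold ent, to_entry, e_exp; cbn [fst]. now apply nth_pure.
Qed.

(* Each of the other variables plays each role exactly once as [c] runs over all rotations. *)
Lemma rotations_total m : length m = S n ->
  lsum (fun c => INR (dot (role_weights r) (other_exps n j0 c m))) (seq 0 n)
  = INR r * (INR r + 1) / 2 * (INR (mdeg m) - INR (nth j0 m 0%nat)).
Proof.
  intros Hm. unfold other_exps.
  assert (Hlen : length (role_weights r) = length (seq 0 n))
    by (unfold role_weights, n; cbn [length]; now rewrite !length_seq).
  rewrite (lsum_ext _ (fun c => lsum (fun p => INR (fst p) * INR (nth (coord n j0 c (snd p)) m 0%nat))
             (combine (role_weights r) (seq 0 n)))) by (intros c _; now apply dot_lsum).
  rewrite lsum_swap.
  set (y := INR (mdeg m) - INR (nth j0 m 0%nat)).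
  assert (Hrow : forall i, lsum (fun c => INR (nth (coord n j0 c i) m 0%nat)) (seq 0 n) = y).
  { intros i. unfold coord.
    rewrite <- (lsum_map (fun v => INR (nth (bump j0 v) m 0%nat)) (fun c => ((i + c) mod n)%nat)).
    rewrite (map_ext (fun c => ((i + c) mod n)%nat) (fun c => ((c + i) mod n)%nat)) by (intros; now rewrite Nat.add_comm).
    rewrite (lsum_perm _ _ _ (rotation_perm n i)). unfold y.
    rewrite <- (other_exps_mdeg n j0 0 Hj0 m Hm), plus_INR. unfold other_exps. rewrite mdeg_lsum.
    rewrite (lsum_ext (fun v => INR (nth (coord n j0 0 v) m 0%nat)) (fun v => INR (nth (bump j0 v) m 0%nat)) (seq 0 n)); [ring|].
    intros v Hv; apply in_seq in Hv. unfold coord. now rewrite Nat.add_0_r, Nat.mod_small by lia. }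
  rewrite (lsum_ext _ (fun p => y * INR (fst p))).
  2:{ intros p _. rewrite lsum_scal, Hrow. ring. }
  rewrite lsum_scal, <- (lsum_map INR fst).
  assert (Hfst : map fst (combine (role_weights r) (seq 0 n)) = role_weights r).
  { revert Hlen; generalize (role_weights r) as w, (seq 0 n) as s. clear.
    induction w as [|x w IH]; intros [|i s] H; try discriminate; [reflexivity|].
    cbn [combine map fst]. now rewrite IH by (now injection H). }
  rewrite Hfst. unfold role_weights. cbn [lsum]. simpl (INR 0).
  assert (Hsum : forall k, lsum INR (seq 0 (S k)) = INR k * (INR k + 1) / 2).
  { induction k as [|k IHk]; [simpl; lra|]. rewrite seq_S, lsum_app, IHk. cbn [lsum Nat.add].
    rewrite S_INR; field. }
  change (INR 0 + lsum INR (seq 1 r)) with (lsum INR (seq 0 (S r))).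
  rewrite Hsum; field.
Qed.

(** The sum of [support_bound] over the [n] rotations. A single rotation could give the monomial the
    heavy roles, while the average depends only on its degree in the other variables. *)
Lemma averaged_bound m : In m (support P) ->
  INR n * ((2 * INR r + 1) * (INR d - INR (nth j0 m 0%nat)) + 5)
  <= INR n * (2 * INR (Nmon P)) + INR r * (INR r + 1) / 2 * (INR d - INR (nth j0 m 0%nat)).
Proof.
  intros Hm. set (k := nth j0 m 0%nat).
  assert (Hd : mdeg m = d) by (apply Hdeg; now apply support_spec).
  pose proof (rotations_total m (support_length m Hm)) as Hrot. rewrite Hd in Hrot.
  set (Y := (2 * INR r + 1) * (INR d - INR k) + 5 - 2 * INR (Nmon P)).
  assert (Hc : forall c, Y <= INR (dot (role_weights r) (other_exps n j0 c m))).
  { intros c. pose proof (support_bound c m Hm) as H. apply le_INR in H.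
    rewrite !plus_INR, !mult_INR, !plus_INR, !mult_INR in H.
    replace (INR 2) with 2 in H by (simpl; ring). replace (INR 5) with 5 in H by (simpl; ring).
    replace (INR 1) with 1 in H by reflexivity. unfold Y, k. lra. }
  assert (Hs : lsum (fun _ => Y) (seq 0 n) <= lsum (fun c => INR (dot (role_weights r) (other_exps n j0 c m))) (seq 0 n))
    by (apply lsum_le; intros; apply Hc).
  assert (Hconst : forall l : list nat, lsum (fun _ => Y) l = INR (length l) * Y).
  { induction l as [|i l IH]; cbn [lsum length]; [simpl; ring|]. rewrite IH, S_INR; ring. }
  rewrite Hconst, length_seq, Hrot in Hs. unfold Y in Hs. fold k in Hs. lra.
Qed.

(** Dividing by the power [k] of the variable [j0] lowers every degree from [d] to [d - k]; with [k]
    the least exponent of that variable this bounds the p-degree. *)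
Lemma factors_lower k : (forall m, In m (support P) -> (k <= nth j0 m 0)%nat) ->
  factors_with_deg n P (d - k).
Proof.
  intros Hk. exists (pure n j0 k), (map (fun m => (lower n j0 k m, coef P m)) (support P)).
  assert (Hpl : forall k', length (pure n j0 k') = S n)
    by (intros; unfold pure; now rewrite length_map, length_seq).
  assert (Hll : forall m, length (lower n j0 k m) = S n)
    by (intros; unfold lower; now rewrite length_map, length_seq).
  assert (Hva : forall m, In m (support P) -> vadd (pure n j0 k) (lower n j0 k m) = m)
    by (intros m Hm; apply vadd_lower; auto using support_length).
  assert (Hdl : forall m, In m (support P) -> mdeg (lower n j0 k m) = (d - k)%nat).
  { intros m Hm. pose proof (mdeg_vadd (pure n j0 k) (lower n j0 k m)) as E.
    rewrite Hva, mdeg_pure in E by auto. rewrite (Hdeg m) in E by now apply support_spec.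
    rewrite E by (now rewrite Hpl, Hll). lia. }
  assert (Hin : forall m, coef (map (fun m => (lower n j0 k m, coef P m)) (support P)) m <> 0 ->
            mdeg m = (d - k)%nat).
  { intros m Hm. destruct (in_dec mono_eq_dec m (map (lower n j0 k) (support P))) as [H|H].
    - apply in_map_iff in H. destruct H as [m' [<- Hm']]; auto.
    - destruct Hm; apply coef_notin. now rewrite map_map. }
  split; [apply Hpl|]. split.
  { unfold wf; rewrite Forall_forall; intros p Hp. apply in_map_iff in Hp; destruct Hp as [m [<- _]]; apply Hll. }
  split; [split|].
  - exists (lower n j0 k (pure n j0 d)). apply support_spec in Hpure as Hp. split; [|auto].
    rewrite (coef_map_inj (lower n j0 k) (coef P)); auto; [apply NoDup_nodup|].
    intros m Hm E. rewrite <- (Hva m Hm), E. auto.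
  - intros m Hm; rewrite (Hin m Hm); apply le_n.
  - intros m. unfold mul_mono; rewrite map_map; cbn [fst snd].
    rewrite (map_ext_in _ (fun m => (m, coef P m))) by (intros m' Hm'; now rewrite Hva).
    rewrite <- (coef_restrict P (fun _ => true)). unfold with_coefs.
    now rewrite filter_true.
Qed.

End Transfer.

(** * From the averaged bound to the p-degree *)

Theorem mainTheorem16 (n : nat) (P : mpoly) (degP pd : nat) :
  (3 <= n)%nat ->
  In_I n P -> mnonzero P -> indecomposable n P ->
  is_deg P degP ->
  (exists j, (j <= n)%nat /\ coef P (pure n j degP) <> 0) ->
  pdegree n P pd ->
  INR pd <= 2 * INR n * (2 * INR (Nmon P) - 5) / (3 * INR n ^ 2 - 3 * INR n - 2) /\
  2 * INR n * (2 * INR (Nmon P) - 5) / (3 * INR n ^ 2 - 3 * INR n - 2)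
    <= 4 / 3 * ((2 * INR (Nmon P) - 5) / (2 * INR n - 3)).
Proof.
  intros Hn HI _ Hindec [[md [Hmd Hmd']] _] [j0 [Hj0 Hpure]] [_ Hpd].
  assert (Hdeg : forall m, coef P m <> 0 -> mdeg m = degP).
  { destruct HI as [_ [[d Hd] _]]. intros m Hm. rewrite <- Hmd'. now rewrite (Hd m Hm), (Hd md Hmd). }
  destruct n as [|[|r]]; [lia|lia|].
  destruct (exists_min (fun m => nth j0 m 0%nat) (support P)) as [m0 [Hm0 Hmin]].
  { intros E. apply support_spec in Hmd. rewrite E in Hmd; destruct Hmd. }
  set (k := nth j0 m0 0%nat) in *.
  pose proof (Hpd _ (factors_lower r j0 degP P Hj0 HI Hdeg Hpure k Hmin)) as Hle.
  pose proof (averaged_bound r j0 degP P Hj0 HI Hindec Hdeg Hpure m0 Hm0) as Hav. fold k in Hav.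
  assert (Hkd : (k <= degP)%nat).
  { rewrite <- (Hdeg m0) by now apply support_spec.
    rewrite <- (other_exps_mdeg (S (S r)) j0 0 Hj0 m0) by now apply (support_length r P HI). unfold k; lia. }
  apply le_INR in Hle. rewrite minus_INR in Hle by exact Hkd.
  apply le_INR in Hkd. pose proof (pos_INR pd) as Hpd0.
  apply le_INR in Hn. simpl (INR 3) in Hn.
  rewrite (S_INR (S r)), (S_INR r) in *.
  set (K := INR degP - INR k) in *. set (x := INR r) in *. set (N := INR (Nmon P)) in *.
  (* With [n = r + 2], twice [n(2r + 1) - r(r + 1)/2] equals [3n^2 - 3n - 2]. *)
  assert (HK : K * (3 * (x + 2) ^ 2 - 3 * (x + 2) - 2) <= 2 * (x + 2) * (2 * N - 5)) by nra.
  assert (Hden : 0 < 3 * (x + 1 + 1) ^ 2 - 3 * (x + 1 + 1) - 2) by nra.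
  assert (H5 : 0 <= 2 * N - 5).
  { assert (0 <= K) by (unfold K; lra).
    assert (0 <= 2 * (x + 2) * (2 * N - 5)) by nra. nra. }
  split.
  - apply Rle_trans with K; [lra|]. apply Rmult_le_reg_r with (3 * (x + 1 + 1) ^ 2 - 3 * (x + 1 + 1) - 2); [exact Hden|].
    unfold Rdiv. rewrite Rmult_assoc, Rinv_l by lra. nra.
  - assert (H2 : 0 < 2 * (x + 1 + 1) - 3) by lra.
    replace (2 * (x + 1 + 1) * (2 * N - 5) / (3 * (x + 1 + 1) ^ 2 - 3 * (x + 1 + 1) - 2))
      with ((2 * N - 5) * (2 * (x + 1 + 1) / (3 * (x + 1 + 1) ^ 2 - 3 * (x + 1 + 1) - 2))) by (field; lra).
    replace (4 / 3 * ((2 * N - 5) / (2 * (x + 1 + 1) - 3)))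
      with ((2 * N - 5) * (4 / 3 / (2 * (x + 1 + 1) - 3))) by (field; lra).
    apply Rmult_le_compat_l; [exact H5|].
    apply Rmult_le_reg_r with ((3 * (x + 1 + 1) ^ 2 - 3 * (x + 1 + 1) - 2) * (2 * (x + 1 + 1) - 3)); [nra|].
    replace (2 * (x + 1 + 1) / _ * _) with (2 * (x + 1 + 1) * (2 * (x + 1 + 1) - 3)) by (field; lra).
    replace (4 / 3 / _ * _) with (4 / 3 * (3 * (x + 1 + 1) ^ 2 - 3 * (x + 1 + 1) - 2)) by (field; lra).
    (* After clearing denominators the claim is [4n^2 - 6n <= 4n^2 - 4n - 8/3]. *)
    nra.
Qed.
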